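(* For $q$ odd and $|u|<1/q$, we have, for each choice of sign, the generating function $$\sum_{n\ge 0}\frac{i(\mathrm{O}^{\pm}(2n,q)\setminus\mathrm{SO}^{\pm}(2n,q))}{|\mathrm{O}^{\pm}(2n,q)|}q^{n^2}u^n=\frac{uq}{2}\,\frac{\prod_{i\ge 1}(1+u/q^{2(i-1)})^2}{\prod_{i\ge 1}(1-u^2/q^{2(i-2)})}.$$
   Context: For $q$ an odd prime power and $\delta$ a fixed nonsquare in $\mathbb{F}_q^{\times}$: $\mathrm{O}^{+}(2n,q)$ is the isometry group on $\mathbb{F}_q^{2n}$ of the quadratic form $x_1x_2+x_3x_4+\cdots+x_{2n-1}x_{2n}$; for $n\ge1$, $\mathrm{O}^{-}(2n,q)$ is that of $x_1x_2+\cdots+x_{2n-3}x_{2n-2}+x_{2n-1}^2-\delta x_{2n}^2$. $\mathrm{SO}^{\pm}(2n,q)$ is the subgroup of determinant $1$ elements of $\mathrm{O}^{\pm}(2n,q)$. $i(X)$ denotes the number of $g\in X$ with $g^2=1$. Conventions: $\mathrm{O}^{+}(0,q)=\mathrm{SO}^{+}(0,q)$ is trivial and $1/|\mathrm{O}^{-}(0,q)|=0$, so the $n=0$ term of each series is $0$. *)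

(* Defs.v *)
From mathcomp Require Import all_boot all_order all_algebra.
From mathcomp Require Import complex.
From mathcomp Require Import classical_sets reals topology normedtype sequences.

Set Implicit Arguments.
Unset Strict Implicit.
Unset Printing Implicit Defensive.

Import Order.TTheory GRing.Theory Num.Theory.
Import numFieldNormedType.Exports.

Local Open Scope classical_set_scope.
Local Open Scope ring_scope.

(* The complex numbers, seen as an abstract [numFieldType] so that they inherit
   the topology of the modulus. *)
Definition cplx (R : realType) : numFieldType := (R[i])%C.

(* With 0-based coordinates, the i-th pair x_{2i+1}, x_{2i+2} of the coordinates
   x_1, ..., x_{2n} sits at positions i.*2 and i.*2.+1. *)
Lemma fst_coord_subproof n (i : 'I_n) : (i.*2 < n.*2)%N.
Proof. by rewrite ltn_double. Qed.

Lemma snd_coord_subproof n (i : 'I_n) : (i.*2.+1 < n.*2)%N.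
Proof. by rewrite ltn_Sdouble. Qed.

Definition fst_coord n (i : 'I_n) : 'I_(n.*2) := Ordinal (fst_coord_subproof i).
Definition snd_coord n (i : 'I_n) : 'I_(n.*2) := Ordinal (snd_coord_subproof i).

Section Orthogonal.
Variables (F : finFieldType) (n : nat).

Definition qform_plus (x : 'rV[F]_(n.*2)) : F :=
  \sum_(i < n) x 0 (fst_coord i) * x 0 (snd_coord i).

(* The last pair of coordinates carries the anisotropic plane. *)
Definition qform_minus (delta : F) (x : 'rV[F]_(n.*2)) : F :=
  \sum_(i < n) (if i.+1 == n
                then x 0 (fst_coord i) ^+ 2 - delta * x 0 (snd_coord i) ^+ 2
                else x 0 (fst_coord i) * x 0 (snd_coord i)).

(* Isometries are given by their matrices, acting on row vectors. *)
Definition isometries (Q : 'rV[F]_(n.*2) -> F) : {set 'M[F]_(n.*2)} :=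
  [set g | (g \in unitmx) && [forall x, Q (x *m g) == Q x]].

Definition det_one (X : {set 'M[F]_(n.*2)}) : {set 'M[F]_(n.*2)} :=
  [set g in X | \det g == 1].

Definition O_plus := isometries qform_plus.
Definition SO_plus := det_one O_plus.

Definition O_minus (delta : F) := isometries (qform_minus delta).
Definition SO_minus (delta : F) := det_one (O_minus delta).

(* The number i(X) of g in X with g^2 = 1. *)
Definition num_invol (X : {set 'M[F]_(n.*2)}) : nat :=
  #|[set g in X | g *m g == 1%:M]|.

End Orthogonal.

Section Series.
Variables (K : numFieldType) (F : finFieldType).

Definition term_plus (u : K) (n : nat) : K :=
  (num_invol (O_plus F n :\: SO_plus F n))%:R / #|O_plus F n|%:R
    * #|F|%:R ^+ (n ^ 2) * u ^+ n.

(* 1 / |O^-(2n, q)|, with the convention 1 / |O^-(0, q)| = 0. *)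
Definition inv_card_O_minus (delta : F) (n : nat) : K :=
  if n is 0 then 0 else #|O_minus n delta|%:R^-1.

Definition term_minus (delta : F) (u : K) (n : nat) : K :=
  (num_invol (O_minus n delta :\: SO_minus n delta))%:R
    * inv_card_O_minus delta n * #|F|%:R ^+ (n ^ 2) * u ^+ n.

End Series.

(* sum_{n >= 0} a n = s *)
Definition has_sum (K : numFieldType) (a : nat -> K) (s : K) : Prop :=
  series a @ \oo --> s.

(* prod_{i >= 1} a i = p; the index starts at 1. *)
Definition has_prod (K : numFieldType) (a : nat -> K) (p : K) : Prop :=
  (fun m : nat => \prod_(1 <= i < m.+1) a i) @ \oo --> p.

(* Main.v *)
(* An involution g of O(Q), Q nondegenerate on F_q^(2n) with q odd, splits the space as the
   orthogonal sum of its (-1)- and 1-eigenspaces, and det g = -1 iff both have odd dimension.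
   In odd dimension the order of the orthogonal group does not depend on the form, and for each
   of the two classes of forms on the (-1)-eigenspace there is exactly one class on the other
   eigenspace; hence the ratio i(O \ SO) / |O| is (1/2) sum_(a + b = n - 1) M_a M_b for both
   types, where M_a^-1 = q^(a^2) prod_(i <= a) (q^(2i) - 1).

   The orders of the orthogonal groups are never computed: pairs (g, P) with P g P^-1 diagonal
   are counted instead, which turns each term into the number of pairs of nondegenerate
   symmetric matrices whose block sum is congruent to the Gram matrix, and congruence is
   decided by the determinant modulo squares.

   With p = q^-2, the resulting series c(u) satisfies (1 + u) c(p u) = (1 - u)(1 - q^2 u^2) c(u);
   iterating it and letting p^N u tend to 0 gives the product. *)
Require Import Defs.
From mathcomp Require Import boolp classical_sets reals topology normedtype sequences.
From mathcomp Require Import all_boot all_order all_algebra.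
From mathcomp Require Import all_fingroup cyclic complex ring zify.

Set Implicit Arguments.
Unset Strict Implicit.
Unset Printing Implicit Defensive.

Import Order.TTheory GRing.Theory Num.Theory.
Import numFieldNormedType.Exports.

Local Open Scope ring_scope.

(** * Congruence of symmetric matrices over a finite field *)

(** The order of the additive group kills 1, so [#|F|%:R] vanishes; if 2 vanished too, an odd
    cardinal would give 1 = 0. *)
Lemma two_neq0_odd_card (F : finFieldType) : odd #|F| -> (2 : F) != 0.
Proof.
move=> oddF; apply/eqP => two0.
have: #|F|%:R = 0 :> F.
  have := expg_cardG (G:=[set: F]%G) (in_setT (1 : F)); rewrite FinRing.zmodXgE cardsT.
  by move=> ->; rewrite FinRing.zmod1gE.
rewrite -[#|F|]odd_double_half oddF -mul2n natrD natrM two0 mul0r addr0.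
by move/eqP; rewrite oner_eq0.
Qed.

(** Polarisation: the value at the sum of the i-th and j-th basis vectors is twice the entry
    [S i j]. *)
Lemma symmetric_qf_eq0 (F : fieldType) n (S : 'M[F]_n) :
  (2 : F) != 0 -> S^T = S -> (forall x : 'rV_n, x *m S *m x^T = 0) -> S = 0.
Proof.
move=> two_neq0 symS S0; apply/matrixP => i j; rewrite mxE.
have E k l : (delta_mx 0 k : 'rV_n) *m S *m (delta_mx 0 l : 'rV_n)^T = (S k l)%:M.
  apply/matrixP => a b; rewrite !ord1 -rowE trmx_delta -colE !mxE.
  by rewrite eqxx mulr1n.
have /matrixP/(_ 0 0) := S0 (delta_mx 0 i + delta_mx 0 j).
rewrite linearD /= !mulmxDl !mulmxDr !S0 !E addr0 add0r !mxE !mulr1n.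
have -> : S j i = S i j by rewrite -[in LHS]symS mxE.
rewrite -mulr2n -mulr_natr => /eqP; rewrite mulf_eq0 (negPf two_neq0) orbF.
by move/eqP.
Qed.

Lemma symmetric_qf_inj (F : fieldType) n (S T : 'M[F]_n) :
  (2 : F) != 0 -> S^T = S -> T^T = T ->
  (forall x : 'rV_n, x *m S *m x^T = x *m T *m x^T) -> S = T.
Proof.
move=> two_neq0 symS symT ST; apply/eqP; rewrite -subr_eq0; apply/eqP.
apply: symmetric_qf_eq0 => // [|x]; first by rewrite linearB /= symS symT.
by rewrite mulmxBr mulmxBl ST subrr.
Qed.

(** In [v = e *m (e^T *m v)] the right factor is singular in general; since [v] and [e] have equal
    rank, it can be replaced by an invertible one. *)
Lemma row0_unitmx (F : fieldType) n (v : 'rV[F]_(1 + n)) :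
  v != 0 -> exists2 h : 'M_(1 + n), h \in unitmx & row_mx 1%:M 0 *m h = v.
Proof.
move=> v_neq0; pose e : 'rV[F]_(1 + n) := row_mx 1%:M 0.
have ev : e *m (e^T *m v) = v.
  by rewrite mulmxA tr_row_mx mul_row_col trmx1 mulmx1 mul0mx addr0 mul1mx.
have e_neq0 : e != 0.
  by apply: contraNneq v_neq0 => e0; rewrite -ev e0 mul0mx.
have: \rank (e *m (e^T *m v)) = \rank e by rewrite ev !rank_rV v_neq0 e_neq0.
by case/complete_unitmx => h hU; rewrite ev => vE; exists h.
Qed.

Definition congruent (F : fieldType) n (C D : 'M[F]_n) :=
  exists2 P : 'M_n, P \in unitmx & P *m C *m P^T = D.

Lemma congruent_trans (F : fieldType) n (C D E : 'M[F]_n) :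
  congruent C D -> congruent D E -> congruent C E.
Proof.
move=> [P uP <-] [Q uQ <-]; exists (Q *m P); first by rewrite unitmx_mul uQ.
by rewrite trmx_mul !mulmxA.
Qed.

Lemma congruent_sym (F : fieldType) n (C D : 'M[F]_n) :
  congruent C D -> congruent D C.
Proof.
move=> [P uP <-]; exists (invmx P); first by rewrite unitmx_inv.
by rewrite !mulmxA mulVmx // mul1mx -mulmxA -trmx_mul mulVmx // trmx1 mulmx1.
Qed.

Lemma congruent_tr (F : fieldType) n (C D : 'M[F]_n) :
  congruent C D -> C^T = C -> D^T = D.
Proof. by move=> [P uP <-] symC; rewrite !trmx_mul trmxK symC mulmxA. Qed.

Lemma congruent_unitmx (F : fieldType) n (C D : 'M[F]_n) :
  congruent C D -> (C \in unitmx) = (D \in unitmx).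
Proof. by move=> [P uP <-]; rewrite !unitmx_mul unitmx_tr uP andbT. Qed.

Lemma congruent_block (F : fieldType) m n (A A' : 'M[F]_m) (B B' : 'M[F]_n) :
  congruent A A' -> congruent B B' ->
  congruent (block_mx A 0 0 B) (block_mx A' 0 0 B').
Proof.
move=> [P uP <-] [Q uQ <-]; exists (block_mx P 0 0 Q).
  by rewrite block_diag_mx_unit uP.
by rewrite tr_block_mx !mulmx_block !trmx0 !(mul0mx, mulmx0, addr0, add0r).
Qed.

Lemma symmetric_block (F : fieldType) m n (A : 'M[F]_m) (B : 'M[F]_n) :
  (block_mx A 0 0 B)^T = block_mx A 0 0 B <-> A^T = A /\ B^T = B.
Proof.
rewrite tr_block_mx !trmx0; split=> [/eq_block_mx[-> _ _ ->]//|[-> ->]//].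
Qed.

Lemma tr_mx11 (F : fieldType) (A : 'M[F]_1) : A^T = A.
Proof. by apply/matrixP => i j; rewrite mxE !ord1. Qed.

(** Gaussian elimination on rows and columns at once: the pivot [a] clears its row and column and
    leaves the Schur complement. *)
Lemma congruent_split_row0 (F : fieldType) n (C : 'M[F]_(1 + n)) (a : F) :
  C^T = C -> a != 0 -> ulsubmx C = a%:M ->
  congruent C (block_mx a%:M 0 0 (drsubmx C - a^-1 *: (dlsubmx C *m ursubmx C))).
Proof.
move=> symC a_neq0 ulC.
have urC : (dlsubmx C)^T = ursubmx C by rewrite trmx_dlsub symC.
exists (block_mx 1%:M 0 (- a^-1 *: dlsubmx C) 1%:M).
  by rewrite unitmxE det_lblock !det1 mulr1 unitr1.
rewrite -[X in _ *m X *m _]submxK ulC tr_block_mx !mulmx_block.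
rewrite !trmx1 trmx0 !(mul0mx, mulmx0, addr0, add0r, mul1mx, mulmx1).
rewrite linearZ /= urC mul_mx_scalar mul_scalar_mx !scalerA.
rewrite mulrN divff // !scaleN1r !addNr mul0mx add0r.
by rewrite -scalemxAl scaleNr addrC.
Qed.

(** Completing [v] to a basis puts [a] into the corner of the Gram matrix, where it serves as
    pivot. *)
Lemma congruent_represented (F : fieldType) n (C : 'M[F]_(1 + n)) (v : 'rV_(1 + n))
    (a : F) :
  C^T = C -> a != 0 -> v *m C *m v^T = a%:M ->
  exists D : 'M_n, congruent C (block_mx a%:M 0 0 D).
Proof.
move=> symC a_neq0 va.
have v_neq0 : v != 0.
  apply: contraNneq a_neq0 => v0; move: va; rewrite v0 mul0mx mul0mx.
  by move/matrixP/(_ 0 0); rewrite !mxE mulr1n => ->.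
have [h uh hv] := row0_unitmx v_neq0.
have Ch : congruent C (h *m C *m h^T) by exists h.
have := @congruent_split_row0 _ _ (h *m C *m h^T) a (congruent_tr Ch symC) a_neq0.
have ulE (X : 'M_(1 + n)) : ulsubmx X = row_mx 1%:M 0 *m X *m (row_mx 1%:M 0)^T.
  rewrite -[in RHS](submxK X) mul_row_block tr_row_mx mul_row_col.
  by rewrite trmx0 trmx1 !(mul0mx, mulmx0, addr0, mul1mx, mulmx1).
rewrite ulE !mulmxA hv -(mulmxA _ h^T) -trmx_mul hv va.
by move=> /(_ erefl) /(congruent_trans Ch) ?; eexists; eassumption.
Qed.

(** * Squares and nonsquares in a finite field *)

Definition is_square (F : finFieldType) (x : F) := [exists y, x == y ^+ 2].

Lemma is_squareM (F : finFieldType) (x y : F) :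
  is_square x -> is_square y -> is_square (x * y).
Proof.
move=> /existsP[a /eqP->] /existsP[b /eqP->]; apply/existsP; exists (a * b).
by rewrite exprMn.
Qed.

Lemma is_square_sqr (F : finFieldType) (x : F) : is_square (x ^+ 2).
Proof. by apply/existsP; exists x. Qed.

Lemma is_squareMsqr (F : finFieldType) (x y : F) :
  y != 0 -> is_square (x * y ^+ 2) = is_square x.
Proof.
move=> y_neq0; apply/idP/idP => [|sx]; last exact: is_squareM (is_square_sqr y).
move=> /is_squareM/(_ (is_square_sqr y^-1)).
by rewrite -mulrA -exprMn mulfV // expr1n mulr1.
Qed.

Definition sqr_image (F : finFieldType) (a b : F) : {set F} :=
  [set a * x ^+ 2 + b | x : F].

(** Fibres of x -> a x^2 + b have at most two elements, so the image fills at least half of the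
    field; exactly half is excluded by parity. *)
Lemma card_sqr_image (F : finFieldType) (a b : F) :
  odd #|F| -> a != 0 -> (#|F| < #|sqr_image a b|.*2)%N.
Proof.
move=> oddF a_neq0; set S := sqr_image a b.
suff: (#|F| <= #|S|.*2)%N by rewrite leq_eqVlt => /orP[/eqP E|//]; rewrite E odd_double in oddF.
rewrite -muln2 -sum_nat_const -sum1_card.
rewrite (partition_big (fun x => a * x ^+ 2 + b) [in S]) /=; last first.
  by move=> x _; apply: imset_f.
apply: leq_sum => _ /imsetP[x _ ->]; rewrite sum1dep_card.
apply: (@leq_trans #|[set x; - x]|); last by rewrite cards2; case: eqP.
apply: subset_leq_card; apply/subsetP => y; rewrite !inE.
by rewrite (inj_eq (addIr b)) (inj_eq (mulfI a_neq0)) eqf_sqr.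
Qed.

Lemma card_gt_meet (T : finType) (A B : {set T}) :
  (#|T| < #|A|.*2)%N -> (#|T| < #|B|.*2)%N -> exists2 x, x \in A & x \in B.
Proof.
move=> hA hB; case: (set_0Vmem (A :&: B)) => [AB0|[x /setIP[xA xB]]]; last by exists x.
have := cardsUI A B; rewrite AB0 cards0 addn0.
have : (#|A :|: B| <= #|T|)%N := max_card _; lia.
Qed.

(** The values a x^2 and the values c - b y^2 each fill more than half of the field, hence share an
    element. *)
Lemma binary_form_represents (F : finFieldType) (a b c : F) :
  odd #|F| -> a != 0 -> b != 0 -> exists x y, a * x ^+ 2 + b * y ^+ 2 = c.
Proof.
move=> oddF a_neq0 b_neq0; have nb_neq0 : - b != 0 by rewrite oppr_eq0.
have [z /imsetP[x _ ->] /imsetP[y _ E]] :=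
  card_gt_meet (card_sqr_image 0 oddF a_neq0) (card_sqr_image c oddF nb_neq0).
by exists x, y; rewrite -[LHS](addr0) addrAC E mulNr addrAC addNr add0r.
Qed.

(** For two nonsquares the argument is a count: were [d * x] a nonsquare, the squares enlarged by
    [x] and the set of all d w^2 would meet at most in 0, yet together they are too large for the
    field. *)
Lemma nonsquareM (F : finFieldType) (d x : F) :
  odd #|F| -> ~~ is_square d -> x != 0 -> is_square (d * x) = ~~ is_square x.
Proof.
move=> oddF nsd x_neq0; apply/idP/idP => [sdx|nsx].
  apply: contraNN nsd => sx; rewrite -(is_squareMsqr d x_neq0) expr2 mulrA.
  exact: is_squareM.
have d_neq0 : d != 0 by apply: contraNneq nsd => ->; apply/existsP; exists 0; rewrite expr0n.
case sdx: (is_square (d * x)) => //; apply/esym/negbTE/negP => _.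
pose S := sqr_image (1 : F) 0; pose A := x |: S; pose B := sqr_image d 0.
have cA : #|A| = #|S|.+1.
  rewrite cardsU1; case: imsetP => // -[y _ E]; case/negP: nsx.
  by rewrite E mul1r addr0 is_square_sqr.
have AB : A :&: B \subset [set 0].
  apply/subsetP => z /setIP[/setU1P[->|/imsetP[y _ ->]] /imsetP[w _ E]].
    by move: sdx; rewrite E addr0 mulrA -expr2 -exprMn is_square_sqr.
  rewrite inE; apply: contraNT nsd => y_neq0.
  have w_neq0 : w != 0 by apply: contraNneq y_neq0 => w0; rewrite E w0 expr0n mulr0 addr0.
  rewrite -(is_squareMsqr d w_neq0); move: E; rewrite !addr0 mul1r => <-.
  exact: is_square_sqr.
have cAB := subset_leq_card AB; rewrite cards1 in cAB.
have cS : (#|F| < #|S|.*2)%N := card_sqr_image 0 oddF (oner_neq0 F).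
have cB : (#|F| < #|B|.*2)%N := card_sqr_image 0 oddF d_neq0.
have cU : (#|A :|: B| <= #|F|)%N := max_card _.
have := cardsUI A B; rewrite cA; lia.
Qed.

(** * Classification of invertible symmetric matrices by the discriminant *)

Lemma congruent_diag_block (F : finFieldType) n (C : 'M[F]_(1 + n)) :
  odd #|F| -> C^T = C -> C \in unitmx ->
  exists2 a : F, a != 0 & exists D : 'M_n, congruent C (block_mx a%:M 0 0 D).
Proof.
move=> oddF symC uC.
have /existsP[v vC] : [exists v : 'rV_(1 + n), v *m C *m v^T != 0].
  apply: contraTT uC => /existsPn C0.
  rewrite (symmetric_qf_eq0 (two_neq0_odd_card oddF) symC) ?unitmxE ?det0 ?unitr0 //.
  by move=> v; apply/eqP; rewrite -[_ == _]negbK C0.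
have va : v *m C *m v^T = ((v *m C *m v^T) 0 0)%:M by rewrite [LHS]mx11_scalar.
have a_neq0 : (v *m C *m v^T) 0 0 != 0.
  by apply: contraNneq vC => a0; rewrite va a0 raddf0.
exists ((v *m C *m v^T) 0 0) => //; exact: congruent_represented va.
Qed.

(** After two pivots a and b are split off, a x^2 + b y^2 represents 1, so (x, y, 0) is a vector of
    value 1. *)
Lemma congruent_one_block (F : finFieldType) n (C : 'M[F]_(1 + (1 + n))) :
  odd #|F| -> C^T = C -> C \in unitmx ->
  exists D : 'M_(1 + n), congruent C (block_mx 1%:M 0 0 D).
Proof.
move=> oddF symC uC.
have [a a_neq0 [C1 CC1]] := congruent_diag_block oddF symC uC.
have uC1 : C1 \in unitmx.
  by move: uC; rewrite (congruent_unitmx CC1) block_diag_mx_unit => /andP[].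
have [_ symC1] := (symmetric_block _ _).1 (congruent_tr CC1 symC).
have [b b_neq0 [C2 CC2]] := congruent_diag_block oddF symC1 uC1.
have aa : congruent a%:M (a%:M : 'M_1).
  by exists 1%:M; rewrite ?unitmx1 // trmx1 mulmx1 mul1mx.
have CE := congruent_trans CC1 (congruent_block aa CC2).
have [x [y xy]] := binary_form_represents 1 oddF a_neq0 b_neq0.
have [|D ED] := @congruent_represented _ _ _ (row_mx x%:M (row_mx y%:M 0)) 1
  (congruent_tr CE symC) (oner_neq0 F).
  rewrite !mul_row_block !tr_row_mx !mul_row_col !(mul0mx, mulmx0, addr0, add0r).
  rewrite mul_row_col mul0mx addr0 !tr_scalar_mx -!scalar_mxM; apply/matrixP => i j.
  by rewrite !ord1 !mxE eqxx !mulr1n -xy; ring.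
by exists D; apply: congruent_trans CE ED.
Qed.

Lemma congruent_det (F : finFieldType) n (C D : 'M[F]_n) :
  C \in unitmx -> congruent C D -> is_square (\det C * \det D).
Proof.
move=> uC [P uP <-]; rewrite !det_mulmx det_tr.
have -> : \det C * (\det P * \det C * \det P) = (\det C * \det P) ^+ 2 by ring.
exact: is_square_sqr.
Qed.

(** By induction: from size 2 on, a block 1 splits off both matrices, and the determinants of the
    remainders still agree modulo squares. *)
Lemma det_square_congruent (F : finFieldType) n (C D : 'M[F]_n) :
  odd #|F| -> C^T = C -> C \in unitmx -> D^T = D -> D \in unitmx ->
  is_square (\det C * \det D) -> congruent C D.
Proof.
move=> oddF; elim: n => [|[|n] IHn] in C D *.
- by move=> *; exists 1%:M; rewrite ?unitmx1 // [LHS]flatmx0 [RHS]flatmx0.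
- rewrite [C]mx11_scalar [D]mx11_scalar !unitmxE !det_scalar1 !unitfE.
  set c := C 0 0; set d := D 0 0 => _ c_neq0 _ d_neq0 /existsP[x /eqP xE].
  have x_neq0 : x != 0.
    by apply: contraTneq (mulf_neq0 c_neq0 d_neq0) => x0; rewrite xE x0 expr0n eqxx.
  (* From c d = x^2, scaling by x / c turns c into x^2 / c = d. *)
  exists (x / c)%:M; first by rewrite unitmxE det_scalar1 unitfE mulf_neq0 ?invr_eq0.
  rewrite tr_scalar_mx -!scalar_mxM; congr (_%:M).
  by rewrite divfK // mulrA -expr2 -xE mulrAC divff // mul1r.
- move=> symC uC symD uD sq; rewrite -[n.+2]/(1 + n.+1)%N in C D symC uC symD uD sq *.
  have [C' CC'] := @congruent_one_block _ n C oddF symC uC.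
  have [D' DD'] := @congruent_one_block _ n D oddF symD uD.
  have [_ symC'] := (symmetric_block _ _).1 (congruent_tr CC' symC).
  have [_ symD'] := (symmetric_block _ _).1 (congruent_tr DD' symD).
  have uC' : C' \in unitmx.
    by move: uC; rewrite (congruent_unitmx CC') block_diag_mx_unit => /andP[].
  have uD' : D' \in unitmx.
    by move: uD; rewrite (congruent_unitmx DD') block_diag_mx_unit => /andP[].
  have C'D' : congruent C' D'.
    apply: IHn => //.
    have := is_squareM (is_squareM (congruent_det uC CC') (congruent_det uD DD')) sq.
    rewrite !det_ublock !det1 !mul1r.
    have -> : \det C * \det C' * (\det D * \det D') * (\det C * \det D) =
      \det C' * \det D' * (\det C * \det D) ^+ 2 by ring.
    by rewrite is_squareMsqr // mulf_neq0 // -unitfE -unitmxE.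
  apply: congruent_trans CC' (congruent_trans _ (congruent_sym DD')).
  apply: congruent_block C'D'.
  by exists 1%:M; rewrite ?unitmx1 // trmx1 mulmx1 mul1mx.
Qed.

(** * Counting involutions *)

Definition ortho (F : finFieldType) n (B : 'M[F]_n) : {set 'M[F]_n} :=
  [set g | (g \in unitmx) && (g *m B *m g^T == B)].

Definition gl_set (F : finFieldType) n : {set 'M[F]_n} := [set h | h \in unitmx].

Definition sym_gl_set (F : finFieldType) n : {set 'M[F]_n} :=
  [set C | (C^T == C) && (C \in unitmx)].

Definition reflection (F : fieldType) k l : 'M[F]_(k + l) := block_mx (- 1%:M) 0 0 1%:M.

Definition block_diagonal (F : fieldType) k l (S : 'M[F]_(k + l)) :=
  (ursubmx S == 0) && (dlsubmx S == 0).

Lemma unitmx_injl (F : fieldType) m n (P : 'M[F]_m) :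
  P \in unitmx -> injective (fun A : 'M_(m, n) => P *m A).
Proof. by move=> uP; apply: can_inj (mulKmx uP). Qed.

Lemma unitmx_injr (F : fieldType) m n (P : 'M[F]_n) :
  P \in unitmx -> injective (fun A : 'M_(m, n) => A *m P).
Proof. by move=> uP; apply: can_inj (mulmxK uP). Qed.

(** With [E = L *m pid_mx r *m U], the first r rows of [U] are fixed by [E] and the rows of
    [invmx L] beyond r are killed by it; together they form the basis [P]. *)
Lemma idempotent_similar_pid (F : fieldType) n (E : 'M[F]_n) :
  E *m E = E -> exists2 P, P \in unitmx & P *m E = pid_mx (\rank E) *m P.
Proof.
set r := \rank E => idE.
pose L := col_ebase E; pose U := row_ebase E.
have uL : L \in unitmx := col_ebase_unit E.
have uU : U \in unitmx := row_ebase_unit E.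
have EE : L *m pid_mx r *m U = E := mulmx_ebase E.
have rn : (r <= n)%N := rank_leq_row E.
have pidL : pid_mx r *m copid_mx r = 0 :> 'M[F]_n.
  by rewrite mulmxBr mulmx1 pid_mx_id // subrr.
have pidR : copid_mx r *m pid_mx r = 0 :> 'M[F]_n.
  by rewrite mulmxBl mul1mx pid_mx_id // subrr.
have pidUE : pid_mx r *m U *m E = pid_mx r *m U :> 'M_n.
  by apply: (unitmx_injl uL); rewrite !mulmxA EE.
have copE : copid_mx r *m invmx L *m E = 0 :> 'M_n.
  by rewrite -EE !mulmxA mulmxKV // pidR mul0mx.
exists (pid_mx r *m U + copid_mx r *m invmx L); last first.
  rewrite mulmxDl pidUE copE mulmxDr !mulmxA pidL pid_mx_id //.
  by rewrite mul0mx.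
(* The left kernel [K] of [P] is zero: applying [E] to [K *m P] gives [K *m pid_mx r = 0], and
   multiplying by [L] then leaves [K] itself. *)
rewrite -row_free_unit -kermx_eq0; apply/eqP.
set P := _ + _; have KP := mulmx_ker P; set K := kermx P in KP *.
have Kpid : K *m pid_mx r = 0 :> 'M_n.
  apply: (unitmx_injr uU); rewrite mul0mx.
  have: K *m P *m E = 0 by rewrite KP mul0mx.
  by rewrite -mulmxA mulmxDl pidUE copE addr0 mulmxA.
have: K *m P *m L = 0 by rewrite KP mul0mx.
rewrite -mulmxA mulmxDl mulmxKV // mulmxDr !mulmxA Kpid !mul0mx add0r.
by rewrite mulmxBr mulmx1 Kpid subr0.
Qed.

Lemma reflectionE (F : fieldType) k l :
  reflection F k l = 1%:M - 2%:R *: pid_mx k.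
Proof.
rewrite pid_mx_block scalar_mx_block scale_block_mx opp_block_mx add_block_mx.
rewrite !scaler0 !subr0; congr block_mx.
by rewrite scaler_nat mulr2n opprD addrA subrr add0r.
Qed.
Lemma reflectionK (F : fieldType) k l :
  reflection F k l *m reflection F k l = 1%:M.
Proof.
rewrite mulmx_block !(mul0mx, mulmx0, addr0, add0r, mul1mx, mulmx1, mulNmx, mulmxN).
by rewrite opprK -scalar_mx_block.
Qed.

Lemma tr_reflection (F : fieldType) k l : (reflection F k l)^T = reflection F k l.
Proof. by rewrite tr_block_mx !trmx0 linearN /= !trmx1. Qed.

Lemma det_reflection (F : fieldType) k l : \det (reflection F k l) = (-1) ^+ k.
Proof. by rewrite det_ublock det1 mulr1 -raddfN /= det_scalar. Qed.

(** The matrix (1 - g) / 2 is the projection onto the (-1)-eigenspace, an idempotent of rank [k]. *)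
Lemma involution_similar_reflection (F : fieldType) k l (g : 'M[F]_(k + l)) :
  (2 : F) != 0 -> g *m g = 1%:M -> \rank (1%:M - g) = k ->
  exists2 P, P \in unitmx & P *m g = reflection F k l *m P.
Proof.
move=> two_neq0 gg rk; pose E := 2^-1 *: (1%:M - g).
have ff : (1%:M - g) *m (1%:M - g) = 2%:R *: (1%:M - g).
  rewrite mulmxBl !mulmxBr gg !mul1mx !mulmx1 scaler_nat mulr2n.
  by rewrite -[in RHS]opprB opprB.
have idE : E *m E = E by rewrite -scalemxAl -scalemxAr ff !scalerA -mulrA mulVf // mulr1.
have [P uP PE] := idempotent_similar_pid idE; exists P => //.
have gE : g = 1%:M - 2%:R *: E by rewrite scalerA divff // scale1r opprB addrC subrK.
rewrite [in LHS]gE mulmxBr mulmx1 -scalemxAr PE mxrank_scale_nz ?invr_eq0 // rk.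
by rewrite reflectionE mulmxBl mul1mx scalemxAl.
Qed.

Lemma reflection_similar_rank (F : fieldType) k l (g P : 'M[F]_(k + l)) :
  (2 : F) != 0 -> P \in unitmx -> P *m g = reflection F k l *m P ->
  \rank (1%:M - g) = k.
Proof.
move=> two_neq0 uP Pg.
have: P *m (1%:M - g) = 2%:R *: (pid_mx k *m P).
  rewrite mulmxBr Pg reflectionE mulmxBl mulmx1 mul1mx opprB addrC subrK.
  by rewrite scalemxAl.
move/(congr1 mxrank); rewrite mxrank_scale_nz //.
rewrite (@mxrankMfree _ _ _ _ (pid_mx k)) ?row_free_unit //.
by rewrite rank_pid_mx ?leq_addr // eqmxMfull // row_full_unit.
Qed.

(** The action of the reflection negates the two off-diagonal blocks and fixes the diagonal ones. *)
Lemma reflection_stabE (F : fieldType) k l (S : 'M[F]_(k + l)) :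
  (2 : F) != 0 ->
  (reflection F k l *m S *m (reflection F k l)^T == S) = block_diagonal S.
Proof.
move=> two_neq0; have opp_eq m n (A : 'M[F]_(m, n)) : (- A == A) = (A == 0).
  rewrite eq_sym -addr_eq0 -mulr2n -scaler_nat scaler_eq0 (negPf two_neq0) //.
rewrite tr_reflection -[in LHS](submxK S) !mulmx_block.
rewrite !(mul0mx, mulmx0, addr0, add0r, mul1mx, mulmx1, mulNmx, mulmxN) opprK.
rewrite /block_diagonal -!opp_eq.
by apply/eqP/andP => [/eq_block_mx[_ -> -> _]|[/eqP-> /eqP->]].
Qed.

(** The reflection is its own inverse and transpose, so commuting with it is the condition of
    [reflection_stabE]; the centraliser is GL_k x GL_l. *)
Lemma card_centraliser_reflection (F : finFieldType) k l :
  (2 : F) != 0 ->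
  #|[set h in gl_set F (k + l) | h *m reflection F k l == reflection F k l *m h]| =
  (#|gl_set F k| * #|gl_set F l|)%N.
Proof.
move=> two_neq0; rewrite -cardsX.
pose f (p : 'M[F]_k * 'M[F]_l) := block_mx p.1 0 0 p.2.
have f_inj : injective f by move=> [a b] [c d] /eq_block_mx /= [-> _ _ ->].
rewrite -(card_imset _ f_inj); apply: eq_card => h; rewrite !inE.
have -> : (h *m reflection F k l == reflection F k l *m h) = block_diagonal h.
  rewrite -reflection_stabE // tr_reflection; apply/eqP/eqP => [<-|E].
    by rewrite -mulmxA reflectionK mulmx1.
  by rewrite -[in LHS]E -!mulmxA reflectionK mulmx1.
apply/andP/imsetP => [[uh /andP[/eqP h1 /eqP h2]]|[[a b]]].
  move: uh; rewrite -[h]submxK h1 h2 block_diag_mx_unit => /andP[ua ub].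
  by exists (ulsubmx h, drsubmx h); rewrite ?inE /= ?ua.
rewrite !inE => /andP[/= ua ub] ->; rewrite block_diag_mx_unit ua ub.
by rewrite /block_diagonal /f block_mxKur block_mxKdl !eqxx.
Qed.

(** * Involutions together with the bases that diagonalise them *)

Definition involutions_of_rank (F : finFieldType) n (B : 'M[F]_n) k :=
  [set g in ortho B | (g *m g == 1%:M) && (\rank (1%:M - g) == k)].

Lemma conjugate_reflectionE (F : fieldType) k l (P g : 'M[F]_(k + l)) :
  P \in unitmx ->
  (invmx P *m reflection F k l *m P == g) = (P *m g == reflection F k l *m P).
Proof.
move=> uP; apply/eqP/eqP => [<-|E]; first by rewrite !mulmxA mulmxV // mul1mx.
by rewrite -mulmxA -E mulKmx.
Qed.

(** In the basis [P] the matrix [g] becomes the reflection, so [g] preserves [B] exactly when its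
    two eigenspaces are orthogonal. *)
Lemma block_diagonal_congruence (F : fieldType) k l (B P g : 'M[F]_(k + l)) :
  (2 : F) != 0 -> P \in unitmx -> P *m g = reflection F k l *m P ->
  block_diagonal (P *m B *m P^T) = (g *m B *m g^T == B).
Proof.
move=> two_neq0 uP Pg; rewrite -reflection_stabE //.
have -> : reflection F k l *m (P *m B *m P^T) *m (reflection F k l)^T =
    P *m (g *m B *m g^T) *m P^T.
  by rewrite !mulmxA -Pg -!mulmxA -!trmx_mul -Pg.
have uPT : P^T \in unitmx by rewrite unitmx_tr.
by apply/eqP/eqP => [/(unitmx_injr uPT)/(unitmx_injl uP)|->].
Qed.

(* Both sides count the pairs (g, P) with P unit and P g P^-1 the diagonal reflection. *)
Lemma card_involutions_mul (F : finFieldType) k l (B : 'M[F]_(k + l)) :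
  (2 : F) != 0 ->
  (#|involutions_of_rank B k| * (#|gl_set F k| * #|gl_set F l|))%N =
  #|[set P in gl_set F (k + l) | block_diagonal (P *m B *m P^T)]|.
Proof.
move=> two_neq0; rewrite -(card_centraliser_reflection k l two_neq0).
pose R := reflection F k l; rewrite -/R -sum_nat_const -[RHS]sum1_card.
rewrite [RHS](partition_big (fun P => invmx P *m R *m P) [in involutions_of_rank B k]) /=.
  apply: eq_bigr => g; rewrite !inE => /andP[/andP[ug /eqP gB] /andP[/eqP gg /eqP rg]].
  (* Once [P0] diagonalises [g], the matrices that do so are the [h *m P0] with [h] in the
     centraliser of [R]. *)
  have [P0 uP0 P0g] := involution_similar_reflection two_neq0 gg rg.
  rewrite sum1dep_card -(card_imset _ (unitmx_injr uP0)).
  apply: eq_card => P; rewrite !inE.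
  transitivity ((P \in unitmx) && (P *m g == R *m P)).
    apply/imsetP/andP => [[h]|[uP /eqP Pg]].
      rewrite !inE => /andP[uh /eqP hR] ->; rewrite unitmx_mul uh uP0; split=> //.
      by rewrite -mulmxA P0g !mulmxA hR.
    exists (P *m invmx P0); last by rewrite mulmxKV.
    rewrite !inE unitmx_mul uP unitmx_inv uP0 /=; apply/eqP.
    apply: (unitmx_injr uP0); rewrite -(mulmxA _ R) -P0g !mulmxA.
    by rewrite !mulmxKV.
  case uP: (P \in unitmx) => //=; rewrite conjugate_reflectionE // -/R.
  have [Pg|] := eqVneq (P *m g) (R *m P); last by rewrite andbF.
  by rewrite andbT (block_diagonal_congruence B two_neq0 uP Pg) gB eqxx.
move=> P; rewrite !inE => /andP[uP]; set g := invmx P *m R *m P.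
have Pg : P *m g = R *m P by apply/eqP; rewrite -conjugate_reflectionE.
rewrite (block_diagonal_congruence B two_neq0 uP Pg) => ->.
rewrite (reflection_similar_rank two_neq0 uP Pg) eqxx andbT.
have gg : g *m g = 1%:M.
  apply: (unitmx_injl uP); rewrite mulmxA Pg -mulmxA Pg mulmxA reflectionK.
  by rewrite mul1mx mulmx1.
by have [-> _] := mulmx1_unit gg; rewrite gg eqxx.
Qed.

(** For n = k + l, [#|F|] odd and [B] symmetric and invertible, these are the pairs whose block sum
    is congruent to [B], in the form decided by [det_square_congruent]. *)
Definition block_pairs (F : finFieldType) n k l (B : 'M[F]_n) :=
  [set c in setX (sym_gl_set F k) (sym_gl_set F l) |
    is_square (\det B * (\det c.1 * \det c.2))].

(** One solution [P0] determines all others as the coset [P0] times [ortho B]. *)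
Lemma card_congruence_fiber (F : finFieldType) n (B S : 'M[F]_n) :
  congruent B S -> #|[set P in gl_set F n | P *m B *m P^T == S]| = #|ortho B|.
Proof.
move=> [P0 uP0 <-]; rewrite -(card_imset (ortho B) (unitmx_injl uP0)).
apply: eq_card => P; rewrite !inE; apply/andP/imsetP => [[uP /eqP PB]|[h]].
  exists (invmx P0 *m P); last by rewrite mulKVmx.
  rewrite inE unitmx_mul unitmx_inv uP0 uP /=; apply/eqP.
  apply: (unitmx_injl uP0); apply: (@unitmx_injr _ _ _ P0^T); first by rewrite unitmx_tr.
  rewrite -PB trmx_mul !mulmxA mulmxV // mul1mx -!mulmxA -trmx_mul mulmxV //.
  by rewrite trmx1 mulmx1.
rewrite inE => /andP[uh /eqP hB] ->; rewrite unitmx_mul uP0 uh; split=> //.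
by rewrite trmx_mul -[in X in _ == X]hB !mulmxA.
Qed.

(** The matrices [P] are sorted by the two diagonal blocks of [P *m B *m P^T]. Every pair in
    [block_pairs] occurs, by the determinant criterion, and every fibre is as large as [ortho B]. *)
Lemma card_block_diagonalisers (F : finFieldType) k l (B : 'M[F]_(k + l)) :
  odd #|F| -> B^T = B -> B \in unitmx ->
  #|[set P in gl_set F (k + l) | block_diagonal (P *m B *m P^T)]| =
  (#|block_pairs k l B| * #|ortho B|)%N.
Proof.
move=> oddF symB uB; rewrite -sum_nat_const -[LHS]sum1_card.
pose S (P : 'M_(k + l)) := P *m B *m P^T.
rewrite [LHS](partition_big (fun P => (ulsubmx (S P), drsubmx (S P))) [in block_pairs k l B]) /=.
  apply: eq_bigr => -[C D]; rewrite !inE /= => /andP[/andP[/andP[/eqP sC uC] /andP[/eqP sD uD]] sq].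
  rewrite sum1dep_card -(@card_congruence_fiber _ _ B (block_mx C 0 0 D)).
    apply: eq_card => P; rewrite !inE -andbA; congr (_ && _).
    apply/andP/eqP => [[/andP[/eqP ur /eqP dl] /eqP[<- <-]]|PB].
      by rewrite -[LHS]submxK ur dl.
    by rewrite /S PB /block_diagonal block_mxKur block_mxKdl block_mxKul block_mxKdr !eqxx.
  apply: det_square_congruent => //; first by apply/symmetric_block.
    by rewrite block_diag_mx_unit uC.
  by rewrite det_ublock.
move=> P; rewrite !inE => /andP[uP /andP[/eqP ur /eqP dl]] /=.
have BS : congruent B (S P) by exists P.
have := congruent_unitmx BS; have := congruent_det uB BS; have := congruent_tr BS symB.
rewrite uB -[S P]submxK ur dl block_mxKul block_mxKdr det_ublock block_diag_mx_unit.
by move=> /symmetric_block[/eqP -> /eqP ->] -> /esym/andP[-> ->].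
Qed.

(** Scaling the first block by the nonsquare [d] multiplies its determinant by d^k, a nonsquare for
    odd [k]. This exchanges the pairs inside and outside [block_pairs], so exactly half of all pairs
    qualify. *)
Lemma card_block_pairs (F : finFieldType) (d : F) n k l (B : 'M[F]_n) :
  odd #|F| -> ~~ is_square d -> odd k -> B \in unitmx ->
  (#|block_pairs k l B|.*2 = #|sym_gl_set F k| * #|sym_gl_set F l|)%N.
Proof.
move=> oddF nsd oddk uB; rewrite -cardsX.
set X := setX _ _; set W := block_pairs k l B.
have d_neq0 : d != 0.
  by apply: contraNneq nsd => ->; apply/existsP; exists 0; rewrite expr0n.
pose f (a : F) (c : 'M[F]_k * 'M[F]_l) := (a *: c.1, c.2).
have fK a : a != 0 -> cancel (f a) (f a^-1).
  by move=> a_neq0 [C D]; rewrite /f /= scalerA mulVf // scale1r.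
have fX a c : a != 0 -> c \in X -> f a c \in X.
  move=> a_neq0; rewrite !inE /= => /andP[/andP[/eqP sC uC] ->]; rewrite andbT.
  by rewrite linearZ /= sC eqxx unitmxZ ?unitfE.
have fW a c : ~~ is_square a -> c \in X -> (f a c \in W) = (c \notin W).
  move=> nsa cX; have a_neq0 : a != 0.
    by apply: contraNneq nsa => ->; apply/existsP; exists 0; rewrite expr0n.
  rewrite [in LHS]inE [in RHS]inE cX fX //= detZ.
  rewrite -[k in a ^+ k]odd_double_half oddk -mul2n exprD expr1 mulnC exprM.
  set x := \det B * (\det c.1 * \det c.2).
  have x_neq0 : x != 0.
    move: cX; rewrite !inE => /andP[/andP[_ u1] /andP[_ u2]].
    by rewrite !mulf_neq0 // -unitfE -unitmxE.
  rewrite -(nonsquareM oddF nsa x_neq0) -[RHS](is_squareMsqr _ (expf_neq0 k./2 a_neq0)).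
  by congr is_square; rewrite /x; ring.
have nsdV : ~~ is_square d^-1.
  apply: contraNN nsd => sdV; have -> : d = d^-1 * d ^+ 2 by field.
  exact: is_squareM sdV (is_square_sqr d).
have fVK : cancel (f d^-1) (f d).
  by move=> [C D]; rewrite /f /= scalerA divff // scale1r.
have WX c : c \in W -> c \in X by rewrite inE => /andP[].
have -> : X = W :|: f d @: W.
  apply/setP => c; rewrite in_setU; apply/idP/orP => [cX|[/WX//|]].
    have [cW|ncW] := boolP (c \in W); [by left|right].
    by rewrite -[c]fVK; apply: imset_f; rewrite fW.
  by case/imsetP => c' /WX c'X ->; apply: fX.
rewrite cardsU (card_imset _ (can_inj (fK d d_neq0))).
have -> : W :&: f d @: W = set0; last by rewrite cards0 subn0 addnn.
apply/setP => c; rewrite in_set0 in_setI; apply/negbTE/negP.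
move=> /andP[cW /imsetP[c' c'W cE]]; move: cW; rewrite cE fW ?c'W //.
exact: WX.
Qed.

(** * Counting symmetric invertible matrices *)

(** Each invertible symmetric matrix with first row (a, v) is recorded by its remaining block. *)
Definition corner_fiber (F : finFieldType) m (a : F) (v : 'rV[F]_m) : {set 'M[F]_m} :=
  [set C | (C^T == C) && (block_mx a%:M v v^T C \in unitmx)].

Lemma card_sym_gl_setS (F : finFieldType) m :
  #|sym_gl_set F (1 + m)| =
  (\sum_(p : F * 'rV[F]_m) #|corner_fiber p.1 p.2|)%N.
Proof.
rewrite -sum1_card.
rewrite (partition_big (fun S : 'M_(1 + m) => (ulsubmx S 0 0, ursubmx S)) predT) //=.
apply: eq_bigr => -[a v] _ /=; rewrite sum1dep_card.
pose f C : 'M_(1 + m) := block_mx a%:M v v^T C.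
have f_inj : injective f by move=> C D /eq_block_mx[].
rewrite -(card_imset _ f_inj); apply: eq_card => S; rewrite !inE.
apply/andP/imsetP => [[/andP[/eqP sS uS] /eqP[aE vE]]|[C]].
  have SE : S = f (drsubmx S).
    by rewrite /f -aE -vE -mx11_scalar trmx_ursub sS submxK.
  exists (drsubmx S) => //; rewrite inE -[block_mx _ _ _ _]/(f _) -SE uS andbT.
  by rewrite trmx_drsub sS.
rewrite inE => /andP[/eqP sC uf] ->; rewrite /f block_mxKul block_mxKur uf.
by rewrite tr_block_mx tr_scalar_mx trmxK sC !eqxx mxE eqxx mulr1n.
Qed.

(** With a nonzero pivot, invertibility is that of the Schur complement; translation by [D] is the
    bijection. *)
Lemma card_corner_fiber_neq0 (F : finFieldType) m (a : F) (v : 'rV[F]_m) :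
  a != 0 -> #|corner_fiber a v| = #|sym_gl_set F m|.
Proof.
move=> a_neq0; pose D := a^-1 *: (v^T *m v).
have sD : D^T = D by rewrite linearZ /= trmx_mul trmxK.
rewrite -(card_imset _ (addIr (- D))); apply: eq_card => C; rewrite !inE.
have key E : E^T = E -> (block_mx a%:M v v^T E \in unitmx) = (E - D \in unitmx).
  move=> sE; have sB : (block_mx a%:M v v^T E)^T = block_mx a%:M v v^T E.
    by rewrite tr_block_mx tr_scalar_mx trmxK sE.
  have ua : a%:M \in @unitmx F 1 by rewrite unitmxE det_scalar1 unitfE.
  rewrite (congruent_unitmx (congruent_split_row0 sB a_neq0 _)) ?block_mxKul //.
  by rewrite block_diag_mx_unit ua block_mxKdr block_mxKdl block_mxKur.
apply/imsetP/andP => [[E]|[/eqP sC uC]].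
  rewrite inE => /andP[/eqP sE]; rewrite key // => uE ->.
  by rewrite linearB /= sD sE.
exists (C + D); last by rewrite addrK.
by rewrite inE linearD /= sD sC eqxx key ?addrK // linearD /= sD sC.
Qed.

Lemma card_corner_fiber00 (F : finFieldType) m :
  #|corner_fiber (0 : F) (0 : 'rV[F]_m)| = 0%N.
Proof.
apply/eqP; rewrite cards_eq0; apply/eqP/setP => C; rewrite !inE trmx0 raddf0.
by rewrite block_diag_mx_unit unitmxE det0 unitr0 andbF.
Qed.

(** A change of basis in the last 1 + m coordinates carries [v] to the first basis vector. *)
Lemma card_corner_fiber0 (F : finFieldType) m (v : 'rV[F]_(1 + m)) :
  v != 0 -> #|corner_fiber 0 v| = #|corner_fiber (0 : F) (row_mx 1%:M 0 : 'rV[F]_(1 + m))|.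
Proof.
move=> /row0_unitmx[h uh <-]; set e := row_mx _ _.
have uhT : h^T \in unitmx by rewrite unitmx_tr.
have hC_inj : injective (fun C : 'M[F]_(1 + m) => h^T *m C *m h).
  by move=> C D /(unitmx_injr uh)/(unitmx_injl uhT).
rewrite -[RHS](card_imset _ hC_inj); apply: eq_card => C.
have key E : (block_mx 0%:M (e *m h) (e *m h)^T (h^T *m E *m h) \in unitmx) =
    (block_mx 0%:M e e^T E \in unitmx).
  symmetry; apply: congruent_unitmx; exists (block_mx 1%:M 0 0 h^T).
    by rewrite block_diag_mx_unit unitmx1.
  rewrite tr_block_mx !mulmx_block !(trmx1, trmx0, trmxK).
  by rewrite !(mul0mx, mulmx0, addr0, add0r, mul1mx, mulmx1) trmx_mul.
rewrite [LHS]inE; apply/andP/imsetP => [[/eqP sC uC]|[E]].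
  exists (invmx h^T *m C *m invmx h); last by rewrite !mulmxA mulmxV // mul1mx mulmxKV.
  rewrite inE -key !mulmxA mulmxV // mul1mx mulmxKV // uC andbT.
  by rewrite !trmx_mul sC !trmx_inv trmxK mulmxA.
rewrite inE => /andP[/eqP sE uE] ->; rewrite key uE; split=> //.
by rewrite !trmx_mul sE trmxK mulmxA.
Qed.

(** The involution [X] exchanges the first two coordinates; multiplied by it on the left, the matrix
    has determinant [\det D] by block triangularity. *)
Lemma unitmx_hyperbolic_corner (F : fieldType) m (c : 'M[F]_1) (w : 'rV[F]_m) (D : 'M_m) :
  (block_mx 0%:M (row_mx 1%:M 0) (row_mx 1%:M 0)^T (block_mx c w w^T D) \in unitmx)
  = (D \in unitmx).
Proof.
pose X : 'M[F]_(1 + (1 + m)) :=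
  block_mx 0 (row_mx 1%:M 0) (row_mx 1%:M 0)^T (block_mx 0 0 0 1%:M).
have XX : X *m X = 1%:M.
rewrite /X tr_row_mx trmx1 trmx0 mulmx_block !mul_row_col. rewrite !mul_col_row
    !mul_block_col !(mul0mx, mulmx0, addr0, add0r, mul1mx, mulmx1) row_mx0 col_mx0.
  rewrite -[X in _ + col_mx X _]row_mx0 -/(block_mx _ _ _ _) add_block_mx.
  by rewrite !(addr0, add0r) -!scalar_mx_block.
have [uX _] := mulmx1_unit XX.
rewrite -[LHS]andTb -[X in X && _]uX -unitmx_mul.
rewrite /X tr_row_mx trmx1 trmx0 mulmx_block !mul_row_col !mul_col_row
    !mul_block_col raddf0 !(mul0mx, mulmx0, addr0, add0r, mul1mx, mulmx1) col_mx0.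
rewrite -[X in _ + col_mx X _]row_mx0 -/(block_mx _ _ _ _) add_block_mx !(addr0, add0r).
by rewrite unitmxE det_ublock det_lblock !det1 !mul1r -unitmxE.
Qed.

Lemma card_corner_fiber01 (F : finFieldType) m :
  #|corner_fiber (0 : F) (row_mx 1%:M 0 : 'rV[F]_(1 + m))| =
  (#|F| * #|F| ^ m * #|sym_gl_set F m|)%N.
Proof.
pose f (p : 'M[F]_1 * 'rV[F]_m * 'M[F]_m) := block_mx p.1.1 p.1.2 p.1.2^T p.2.
have f_inj : injective f by move=> [[a b] c] [[a' b'] c'] /eq_block_mx /= [-> -> _ ->].
transitivity #|setX (setX [set: 'M[F]_1] [set: 'rV[F]_m]) (sym_gl_set F m)|; last first.
  by rewrite !cardsX !cardsT !card_mx !mul1n.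
rewrite -(card_imset _ f_inj); apply: eq_card => C; rewrite inE.
apply/andP/imsetP => [[/eqP sC uC]|[[[c w] D]]].
  have CE : C = f (ulsubmx C, ursubmx C, drsubmx C).
    by rewrite /f /= trmx_ursub sC submxK.
  exists (ulsubmx C, ursubmx C, drsubmx C) => //; move: uC.
  by rewrite {1}CE /f /= unitmx_hyperbolic_corner !inE /= trmx_drsub sC eqxx.
rewrite !inE /= => /andP[/eqP sD uD] ->; rewrite unitmx_hyperbolic_corner uD.
by rewrite tr_block_mx tr_mx11 trmxK sD eqxx.
Qed.

Lemma card_sym_gl_set0 (F : finFieldType) : #|sym_gl_set F 0| = 1%N.
Proof.
rewrite (_ : sym_gl_set F 0 = [set 0]) ?cards1 //; apply/setP => C.
by rewrite (flatmx0 C) !inE trmx0 !eqxx unitmxE det_mx00 unitr1.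
Qed.

Lemma card_gl_set0 (F : finFieldType) : #|gl_set F 0| = 1%N.
Proof.
rewrite (_ : gl_set F 0 = [set 0]) ?cards1 //; apply/setP => C.
by rewrite (flatmx0 C) !inE eqxx unitmxE det_mx00 unitr1.
Qed.

Lemma card_sym_gl_set_corner (F : finFieldType) m :
  #|sym_gl_set F (1 + m)| =
  ((#|F| - 1) * #|F| ^ m * #|sym_gl_set F m| +
   \sum_(v : 'rV[F]_m | v != 0%R) #|corner_fiber (0%R : F) v|)%N.
Proof.
rewrite card_sym_gl_setS -(pair_bigA _ (fun a v => #|corner_fiber a v|)) /=.
rewrite (bigD1 0) //= addnC; congr (_ + _)%N.
  rewrite (eq_bigr (fun _ => #|F| ^ m * #|sym_gl_set F m|)%N) => [|a a_neq0].
    by rewrite sum_nat_const cardC1 mulnA subn1.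
  rewrite (eq_bigr (fun _ => #|sym_gl_set F m|)) => [|v _].
    by rewrite sum_nat_const card_mx mul1n.
  exact: card_corner_fiber_neq0.
by rewrite (bigD1 0) //= card_corner_fiber00.
Qed.

Lemma card_sym_gl_set1 (F : finFieldType) : #|sym_gl_set F 1| = (#|F| - 1)%N.
Proof.
rewrite [LHS](card_sym_gl_set_corner F 0) card_sym_gl_set0 expn0 !muln1.
by rewrite big1 ?addn0 // => v; rewrite thinmx0 eqxx.
Qed.

Lemma card_sym_gl_setSS (F : finFieldType) m :
  #|sym_gl_set F m.+2| =
  ((#|F| - 1) * #|F| ^ m.+1 * #|sym_gl_set F m.+1| +
   (#|F| ^ m.+1 - 1) * #|F| ^ m.+1 * #|sym_gl_set F m|)%N.
Proof.
rewrite [LHS](card_sym_gl_set_corner F m.+1); congr (_ + _)%N.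
rewrite (eq_bigr (fun _ => #|F| ^ m.+1 * #|sym_gl_set F m|)%N) => [|v v_neq0].
  by rewrite sum_nat_const cardC1 card_mx mul1n mulnA subn1.
by rewrite [LHS](@card_corner_fiber0 F m v v_neq0) card_corner_fiber01 -expnS.
Qed.

(** The recursion of [card_sym_gl_setSS] reaches back two sizes, so both parities are carried
    through one induction. *)
Lemma card_sym_gl_setE (F : finFieldType) a :
  #|sym_gl_set F a.*2| = (#|F| ^ (a * a.+1) * \prod_(i < a) (#|F| ^ i.*2.+1 - 1))%N /\
  #|sym_gl_set F a.*2.+1| =
    (#|F| ^ (a * a.+1) * \prod_(i < a.+1) (#|F| ^ i.*2.+1 - 1))%N.
Proof.
have q_gt0 : (0 < #|F|)%N by apply/card_gt0P; exists 0.
have expP k : (#|F| ^ k - 1 + 1 = #|F| ^ k)%N by rewrite subnK // expn_gt0 q_gt0.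
elim: a => [|a [IH0 IH1]].
  by rewrite double0 card_sym_gl_set0 card_sym_gl_set1 big_ord0 big_ord1 mul0n expn0 expn1 !mul1n.
have E0 : #|sym_gl_set F a.+1.*2| =
    (#|F| ^ (a.+1 * a.+2) * \prod_(i < a.+1) (#|F| ^ i.*2.+1 - 1))%N.
  rewrite doubleS card_sym_gl_setSS IH0 IH1 big_ord_recr /=.
  have -> : (a.+1 * a.+2 = a * a.+1 + a.*2.+1 + 1)%N by lia.
  (* Writing [#|F|] as x + 1 removes the truncated subtraction before [ring]. *)
  have := expP 1%N; rewrite !expnD !expn1.
  move: (\prod_(i < a) _)%N (#|F| ^ (a * a.+1))%N (#|F| ^ a.*2.+1)%N (#|F| - 1)%N => P Q Y x <-.
  ring.
split=> //; rewrite doubleS card_sym_gl_setSS -doubleS E0 IH1 [in RHS]big_ord_recr /=.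
set Pr := (\prod_(i < a.+1) _)%N.
have E1 := expP a.+1.*2; have E2 := expP 1%N; have E3 := expP a.+1.*2.+1.
rewrite expn1 in E2.
have -> : (a.+1 * a.+2 = a * a.+1 + a.+1.*2)%N by lia.
rewrite expnD; set Q := (#|F| ^ (a * a.+1))%N.
move: E3; rewrite expnS; set Y := (#|F| ^ a.+1.*2)%N in E1 *.
move=> E3; move: E1 E2 E3; move: (Y - 1)%N (#|F| * Y - 1)%N (#|F| - 1)%N => y z q E1 E2 E3.
(* Here [q] stands for [#|F| - 1], so [z] is (q + 1) Y - 1. *)
have -> : z = (q * Y + y)%N by move: E3; rewrite -E2 -E1; nia.
ring.
Qed.

Lemma card_gl_setE (F : finFieldType) n :
  #|gl_set F n| = (#|F| ^ 'C(n, 2) * \prod_(1 <= i < n.+1) (#|F| ^ i - 1))%N.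
Proof.
case: n => [|n]; first by rewrite card_gl_set0 big_geq.
rewrite -card_GL // cardsT card_sub; apply: eq_card => h.
by rewrite inE.
Qed.

(** Among the factors q^i - 1 of the order of GL, those with odd i make up the count of symmetric
    matrices and those with even i remain. *)
Lemma card_gl_set_odd (F : finFieldType) a :
  #|gl_set F a.*2.+1| =
  (#|sym_gl_set F a.*2.+1| * #|F| ^ (a ^ 2) * \prod_(1 <= i < a.+1) (#|F| ^ (2 * i) - 1))%N.
Proof.
rewrite card_gl_setE (card_sym_gl_setE F a).2.
have -> : 'C(a.*2.+1, 2) = (a * a.+1 + a ^ 2)%N.
  by rewrite bin2 /= -doubleMr half_double; lia.
rewrite expnD -!mulnA; congr (_ * _)%N; rewrite mulnCA; congr (_ * _)%N.
elim: a => [|a IHa]; first by rewrite double0 big_nat1 big_ord1 big_geq // muln1.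
rewrite doubleS [LHS]big_nat_recr //= big_nat_recr //= IHa [in RHS]big_ord_recr
   [in RHS]big_nat_recr //=.
rewrite mul2n doubleS.
ring.
Qed.

(** * The proportion of involutions outside the special orthogonal group *)

(** The form [B] enters the right-hand side only through the order of its orthogonal group, whence
    the same ratio for both signs. *)
Lemma card_involutions_odd_rank (F : finFieldType) (d : F) n k l (B : 'M[F]_n) :
  odd #|F| -> ~~ is_square d -> B^T = B -> B \in unitmx -> n = (k + l)%N -> odd k ->
  ((#|involutions_of_rank B k| * (#|gl_set F k| * #|gl_set F l|)).*2 =
   #|ortho B| * (#|sym_gl_set F k| * #|sym_gl_set F l|))%N.
Proof.
move=> oddF nsd symB uB En oddk; subst n.
rewrite card_involutions_mul ?two_neq0_odd_card // card_block_diagonalisers //.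
by rewrite doubleMl (card_block_pairs l oddF nsd oddk uB) mulnC.
Qed.

Lemma det_involution (F : fieldType) n (g : 'M[F]_n) :
  (2 : F) != 0 -> g *m g = 1%:M -> \det g = (-1) ^+ \rank (1%:M - g).
Proof.
move=> two_neq0 gg.
pose k := \rank (1%:M - g); have rk : \rank (1%:M - g) = k by [].
have := subnKC (rank_leq_row (1%:M - g)); rewrite !rk; clearbody k.
move: (n - k)%N => l En; subst n.
have [P uP Pg] := involution_similar_reflection two_neq0 gg rk.
have := congr1 determinant Pg; rewrite !det_mulmx det_reflection mulrC.
by apply: mulIf; rewrite -unitfE -unitmxE.
Qed.

(** An involution has determinant different from 1 exactly when its (-1)-eigenspace has odd
    dimension 2a + 1; here a < n. *)
Lemma num_invol_not_det_one (F : finFieldType) n (B : 'M[F]_(n.*2)) :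
  odd #|F| ->
  num_invol (ortho B :\: det_one (ortho B)) =
  (\sum_(a < n) #|involutions_of_rank B a.*2.+1|)%N.
Proof.
(* Size 0 is treated apart because [inord] below needs a nonempty index type; there the determinant
   is always 1. *)
case: n B => [|n] B oddF.
  rewrite big_ord0; apply/eqP; rewrite cards_eq0; apply/eqP/setP => g; rewrite !inE.
  by rewrite [\det g](@det_mx00 F g) eqxx andbT andNb.
have two_neq0 := two_neq0_odd_card oddF.
have det_odd (g : 'M[F]_(n.+1.*2)) : g *m g = 1%:M ->
    (\det g != 1) = odd (\rank (1%:M - g)).
  move=> gg; rewrite det_involution // -signr_odd; case: odd; last by rewrite eqxx.
  by rewrite expr1 eq_sym -addr_eq0.
rewrite /num_invol -sum1_card.
have rank_lt (g : 'M[F]_(n.+1.*2)) : odd (\rank (1%:M - g)) ->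
    ((\rank (1%:M - g)%R)./2 < n.+1)%N.
  move=> odd_r; have := rank_leq_row (1%:M - g).
  rewrite -{1}[\rank _]odd_double_half odd_r; lia.
transitivity (\sum_(g in ortho B | (g *m g == 1%:M)%R && odd (\rank (1%:M - g)%R)) 1)%N.
  apply: eq_bigl => g; rewrite !inE -!andbA; case: (g \in unitmx) => //=.
  case: (g *m B *m g^T == B) => //=; rewrite ?andbF //= ?andbT.
  case: (g *m g =P 1%:M) => [gg|_]; rewrite ?andbF //. by rewrite andbT -det_odd.
pose f (g : 'M[F]_(n.+1.*2)) : 'I_n.+1 := inord (\rank (1%:M - g)%R)./2.
etransitivity; first by apply: (partition_big f predT).
apply: eq_bigr => a _; rewrite sum1dep_card; apply: eq_card => g.
rewrite !inE -!andbA; do 3 congr (_ && _).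
apply/andP/eqP => [[odd_r /eqP <-]|r_eq].
  rewrite inordK ?rank_lt //; rewrite -[LHS]odd_double_half odd_r; lia.
split; first by rewrite r_eq /= odd_double.
by apply/eqP/val_inj; rewrite /f r_eq /= uphalf_double inordK.
Qed.

(* For q = #|F| this is |Sym_{2a+1} cap GL| / |GL_{2a+1}|, the mass of the nondegenerate
   quadratic forms in 2a+1 variables. *)
Definition odd_mass (K : fieldType) (q : K) (a : nat) : K :=
  (q ^+ (a ^ 2) * \prod_(1 <= i < a.+1) (q ^+ (2 * i) - 1))^-1.

Section Mass.
Variables (K : numFieldType) (F : finFieldType).

Lemma odd_massE a :
  odd_mass (#|F|%:R : K) a = #|sym_gl_set F a.*2.+1|%:R / #|gl_set F a.*2.+1|%:R.
Proof.
have q_gt1 : (1 < #|F|)%N := card_finNzRing_gt1 F.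
have s_neq0 : #|sym_gl_set F a.*2.+1|%:R != 0 :> K.
  rewrite pnatr_eq0 -lt0n; apply/card_gt0P; exists 1%:M.
  by rewrite inE trmx1 eqxx unitmx1.
rewrite card_gl_set_odd !natrM invfM invfM mulrA mulrA mulfV // mul1r.
rewrite /odd_mass invfM natrX natr_prod; congr (_ * _^-1).
apply: eq_big_nat => i _; rewrite natrB ?natrX // expn_gt0.
by rewrite (ltnW q_gt1).
Qed.

(** Both eigenspaces have odd dimension, 2a + 1 and 2(n - a - 1) + 1, so each contributes an
    [odd_mass]; the factor 1/2 is the determinant condition on pairs. *)
Lemma num_invol_mass (d : F) n (B : 'M[F]_(n.*2)) :
  odd #|F| -> ~~ is_square d -> B^T = B -> B \in unitmx ->
  (num_invol (ortho B :\: det_one (ortho B)))%:R / #|ortho B|%:R =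
  2^-1 * \sum_(a < n) odd_mass #|F|%:R a * odd_mass #|F|%:R (n - a.+1) :> K.
Proof.
move=> oddF nsd symB uB; rewrite num_invol_not_det_one // natr_sum mulr_suml mulr_sumr.
apply: eq_bigr => a _; rewrite !odd_massE.
set k := a.*2.+1; set l := (n - a.+1).*2.+1.
have nkl : n.*2 = (k + l)%N by rewrite /k /l; have := ltn_ord a; lia.
have oddk : odd k by rewrite /k /= odd_double.
have := card_involutions_odd_rank oddF nsd symB uB nkl oddk.
move/(congr1 (fun m : nat => m%:R : K)); rewrite -muln2 !natrM => E.
have nz n' (A : {set 'M[F]_n'}) : 1%:M \in A -> #|A|%:R != 0 :> K.
  by move=> A1; rewrite pnatr_eq0 -lt0n; apply/card_gt0P; exists 1%:M.
have Onz : #|ortho B|%:R != 0 :> K.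
  by apply: nz; rewrite inE unitmx1 trmx1 mulmx1 mul1mx eqxx.
have GLk : #|gl_set F k|%:R != 0 :> K by apply: nz; rewrite inE unitmx1.
have GLl : #|gl_set F l|%:R != 0 :> K by apply: nz; rewrite inE unitmx1.
have two_nz : (2 : K) != 0 by rewrite pnatr_eq0.
apply: (mulfI two_nz); apply: (mulIf Onz); apply: (mulIf GLk); apply: (mulIf GLl).
transitivity (#|ortho B|%:R * (#|sym_gl_set F k|%:R * #|sym_gl_set F l|%:R) : K).
  by rewrite -E; field.
by field; rewrite GLl GLk.
Qed.

End Mass.

(** * Orthogonal sums of binary quadratic forms and their Gram matrices *)

Section PlaneForms.
Variables (F : finFieldType) (n : nat) (al be ga : 'I_n -> F).

(** A common shape for [qform_plus] and [qform_minus], so that both signs share one argument. *)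
Definition planes_qform (x : 'rV[F]_(n.*2)) : F :=
  \sum_(i < n) (al i * x 0 (fst_coord i) ^+ 2 + be i * x 0 (snd_coord i) ^+ 2
                + ga i * (x 0 (fst_coord i) * x 0 (snd_coord i))).

Definition planes_gram : 'M[F]_(n.*2) :=
  \sum_(i < n) (al i *: delta_mx (fst_coord i) (fst_coord i)
    + be i *: delta_mx (snd_coord i) (snd_coord i)
    + (ga i / 2) *: (delta_mx (fst_coord i) (snd_coord i)
                     + delta_mx (snd_coord i) (fst_coord i))).

Lemma planes_gramE (x y : 'rV[F]_(n.*2)) :
  (x *m planes_gram *m y^T) 0 0 =
  \sum_(i < n) (al i * (x 0 (fst_coord i) * y 0 (fst_coord i))
    + be i * (x 0 (snd_coord i) * y 0 (snd_coord i))
    + ga i / 2 * (x 0 (fst_coord i) * y 0 (snd_coord i)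
                  + x 0 (snd_coord i) * y 0 (fst_coord i))).
Proof.
have D a b : x *m delta_mx a b *m y^T = (x 0 a * y 0 b)%:M.
  rewrite -(mul_delta_mx (0 : 'I_1)) mulmxA -colE -mulmxA -rowE.
  by apply/matrixP => i j; rewrite !ord1 mxE big_ord1 !mxE eqxx mulr1n.
rewrite mulmx_sumr mulmx_suml summxE; apply: eq_bigr => i _.
rewrite !scalerDr !mulmxDr !mulmxDl -!scalemxAr -!scalemxAl !D !mxE eqxx !mulr1n.
by rewrite mulrDr.
Qed.

Lemma planes_gram_sym : planes_gram^T = planes_gram.
Proof.
rewrite /planes_gram linear_sum; apply: eq_bigr => i _.
by rewrite !linearE /= !trmx_delta scalerDr; congr (_ + _); apply: addrC.
Qed.

Hypothesis two_neq0 : (2 : F) != 0.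

(** Pairing a kernel vector with the basis vectors gives a separate 2 x 2 system for each plane,
    whose determinant is nonzero by the discriminant condition. *)
Lemma planes_gram_unit :
  (forall i, 4 * (al i * be i) != ga i ^+ 2) -> planes_gram \in unitmx.
Proof.
move=> disc; rewrite -row_free_unit -kermx_eq0; apply/rowV0P => x /sub_kermxP xB.
have fs i j : (fst_coord i == snd_coord j) = false.
  by apply/negbTE/eqP => /(congr1 val) /=; lia.
have f_inj i j : (fst_coord i == fst_coord j) = (i == j).
  by apply/eqP/eqP => [/(congr1 val) /= E|->//]; apply: val_inj => /=; lia.
have s_inj i j : (snd_coord i == snd_coord j) = (i == j).
  by apply/eqP/eqP => [/(congr1 val) /= E|->//]; apply: val_inj => /=; lia.
have Ef j : al j * x 0 (fst_coord j) + ga j / 2 * x 0 (snd_coord j) = 0.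
  have := planes_gramE x (delta_mx 0 (fst_coord j)); rewrite xB mul0mx mxE => ->.
  rewrite (bigD1 j) //= big1 => [|i ij].
    by rewrite !mxE !eqxx ![snd_coord _ == _]eq_sym fs /= !(mulr0, mulr1, addr0, add0r).
  by rewrite !mxE ![snd_coord _ == _]eq_sym fs f_inj (negPf ij) /= !(mulr0, addr0).
have Es j : be j * x 0 (snd_coord j) + ga j / 2 * x 0 (fst_coord j) = 0.
  have := planes_gramE x (delta_mx 0 (snd_coord j)); rewrite xB mul0mx mxE => ->.
  rewrite (bigD1 j) //= big1 => [|i ij].
    by rewrite !mxE !eqxx fs /= !(mulr0, mulr1, addr0, add0r).
  by rewrite !mxE fs s_inj (negPf ij) /= !(mulr0, addr0).
have xf j : x 0 (fst_coord j) = 0 /\ x 0 (snd_coord j) = 0.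
  have nz : 4 * (al j * be j) - ga j ^+ 2 != 0 by rewrite subr_eq0.
  split; apply: (mulfI nz); rewrite mulr0.
    transitivity (4 * be j * (al j * x 0 (fst_coord j) + ga j / 2 * x 0 (snd_coord j))
      - 2 * ga j * (be j * x 0 (snd_coord j) + ga j / 2 * x 0 (fst_coord j))).
      by field.
    by rewrite Ef Es !mulr0 subr0.
  transitivity (4 * al j * (be j * x 0 (snd_coord j) + ga j / 2 * x 0 (fst_coord j))
      - 2 * ga j * (al j * x 0 (fst_coord j) + ga j / 2 * x 0 (snd_coord j))).
    by field.
  by rewrite Ef Es !mulr0 subr0.
apply/rowP => c; rewrite mxE.
have c_lt : (c./2 < n)%N by have := ltn_ord c; lia.
have := xf (Ordinal c_lt); case: (boolP (odd c)) => oddc [x0 x1].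
  by rewrite -x1; congr (x _ _); apply: val_inj => /=; lia.
by rewrite -x0; congr (x _ _); apply: val_inj => /=; lia.
Qed.

(** In odd characteristic a quadratic form determines its symmetric Gram matrix, by
    [symmetric_qf_inj]. *)
Lemma isometries_planes_qform : isometries planes_qform = ortho planes_gram.
Proof.
have QB x : planes_qform x = (x *m planes_gram *m x^T) 0 0.
  by rewrite planes_gramE; apply: eq_bigr => i _; field.
apply/setP => g; rewrite !inE; congr (_ && _).
apply/forallP/eqP => [Qg|gB x]; last first.
  by rewrite !QB trmx_mul !mulmxA -[_ *m _ *m g^T]mulmxA -[in X in _ == X]gB !mulmxA.
apply: symmetric_qf_inj => // [||x].
- by rewrite !trmx_mul trmxK planes_gram_sym mulmxA.
- exact: planes_gram_sym.
have /eqP := Qg x; rewrite !QB trmx_mul => E.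
apply/matrixP => i j; rewrite !ord1 -E !mulmxA //.
Qed.

End PlaneForms.

Lemma eq_isometries (F : finFieldType) n (Q Q' : 'rV[F]_(n.*2) -> F) :
  Q =1 Q' -> isometries Q = isometries Q'.
Proof.
move=> QQ'; apply/setP => g; rewrite !inE; congr (_ && _).
by apply: eq_forallb => x; rewrite !QQ'.
Qed.

Lemma planes_mass (K : numFieldType) (F : finFieldType) (d : F) n (al be ga : 'I_n -> F)
    (Q : 'rV[F]_(n.*2) -> F) :
  odd #|F| -> ~~ is_square d -> Q =1 planes_qform al be ga ->
  (forall i, 4 * (al i * be i) != ga i ^+ 2) ->
  (num_invol (isometries Q :\: det_one (isometries Q)))%:R / #|isometries Q|%:R =
  2^-1 * \sum_(a < n) odd_mass #|F|%:R a * odd_mass #|F|%:R (n - a.+1) :> K.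
Proof.
move=> oddF nsd QE disc; have two_neq0 := two_neq0_odd_card oddF.
rewrite (eq_isometries QE) isometries_planes_qform //.
by apply: (num_invol_mass K oddF nsd); [apply: planes_gram_sym | apply: planes_gram_unit].
Qed.

(** The nonsquare [d] does not occur in the form; it serves the halving in [card_block_pairs]. *)
Lemma plus_mass (K : numFieldType) (F : finFieldType) (d : F) n :
  odd #|F| -> ~~ is_square d ->
  (num_invol (O_plus F n :\: SO_plus F n))%:R / #|O_plus F n|%:R =
  2^-1 * \sum_(a < n) odd_mass #|F|%:R a * odd_mass #|F|%:R (n - a.+1) :> K.
Proof.
move=> oddF nsd.
apply: (planes_mass K (al := fun=> 0) (be := fun=> 0) (ga := fun=> 1) oddF nsd) => [x|i].
  by apply: eq_bigr => i _; rewrite !mul0r !add0r mul1r.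
by rewrite mul0r mulr0 expr1n eq_sym oner_eq0.
Qed.

Lemma minus_mass (K : numFieldType) (F : finFieldType) (d : F) n :
  odd #|F| -> ~~ is_square d ->
  (num_invol (O_minus n d :\: SO_minus n d))%:R / #|O_minus n d|%:R =
  2^-1 * \sum_(a < n) odd_mass #|F|%:R a * odd_mass #|F|%:R (n - a.+1) :> K.
Proof.
move=> oddF nsd; pose last (i : 'I_n) := i.+1 == n.
(* The last plane carries x^2 - d y^2 and all others x y; the condition on the last plane reads -4d
   != 0. *)
apply: (planes_mass K (al := fun i => (last i)%:R) (be := fun i => - (d *+ last i))
  (ga := fun i => (~~ last i)%:R) oddF nsd) => [x|i].
  by apply: eq_bigr => i _; rewrite /last; case: eqP => _ /=; ring.
case: (last i) => /=; last by rewrite mul0r mulr0 expr1n eq_sym oner_eq0.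
have d_neq0 : d != 0 by apply: contraNneq nsd => ->; apply/existsP; exists 0; rewrite expr0n.
rewrite expr0n /= mul1r mulrN oppr_eq0 mulf_neq0 //.
have -> : (4 : F) = 2 ^+ 2 by ring.
by rewrite expf_neq0 // two_neq0_odd_card.
Qed.

(** * Absolutely convergent complex series *)

Lemma real_absolutely_summable (R : realType) (a : nat -> R) (M : R) :
  (forall n, \sum_(i < n) `|a i| <= M) -> cvgn (series a).
Proof.
move=> aM; apply: normed_cvg; apply: nondecreasing_is_cvgn.
  apply/nondecreasing_seqP => n; rewrite /= -subr_ge0 seriesSB.
  exact: normr_ge0.
exists M => _ [n _ <-]; rewrite /normed_series_of seriesEord; exact: aM.
Qed.

Lemma Re_sum (R : realType) (a : nat -> cplx R) n :
  complex.Re (series a n : R[i]%C) = series (fun i => complex.Re (a i : R[i]%C)) n.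
Proof. by rewrite /series /=; elim/big_rec2: _ => // i x y _ <-; case: (a i) => ? ?; case: y. Qed.

Lemma Im_sum (R : realType) (a : nat -> cplx R) n :
  complex.Im (series a n : R[i]%C) = series (fun i => complex.Im (a i : R[i]%C)) n.
Proof. by rewrite /series /=; elim/big_rec2: _ => // i x y _ <-; case: (a i) => ? ?; case: y. Qed.

Lemma norm_Re_le (R : realType) (z : cplx R) :
  ((`|complex.Re (z : R[i]%C)|%:C)%C : cplx R) <= `|z|.
Proof. exact: normc_ge_Re. Qed.

Lemma norm_Im_le (R : realType) (z : cplx R) :
  ((`|complex.Im (z : R[i]%C)|%:C)%C : cplx R) <= `|z|.
Proof.
have i1 : `|('i%C : cplx R)| = 1.
  rewrite [LHS](normc_def ('i%C : R[i]%C)) /= expr0n /= add0r expr1n sqrtr1 //.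
have := norm_Re_le (z * 'i%C); rewrite normrM i1 mulr1; apply: le_trans.
by rewrite ReiNIm normrN.
Qed.

Lemma norm_complex_le (R : realType) (z : cplx R) :
  `|z| <= ((`|complex.Re (z : R[i]%C)| + `|complex.Im (z : R[i]%C)|)%:C)%C.
Proof.
case: z => x y /=; rewrite [leLHS](normc_def (Complex x y)) lecR /=.
rewrite -[leRHS]ger0_norm ?addr_ge0 ?normr_ge0 // -sqrtr_sqr ler_wsqrtr //.
rewrite sqrrD !real_normK ?num_real // -addrA lerD2l lerDr.
by rewrite mulrn_wge0 // mulr_ge0.
Qed.

(** Real and imaginary parts are dominated by the modulus, so each converges absolutely, with the
    real part of [M] as bound. *)
Lemma cplx_absolutely_summable (R : realType) (a : nat -> cplx R) (M : cplx R) :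
  (forall n, \sum_(i < n) `|a i| <= M) -> exists s, has_sum a s.
Proof.
move=> aM.
have re_sum b n : (forall i, ((b i)%:C)%C <= `|a i|) -> \sum_(i < n) b i <= complex.Re (M : R[i]%C).
  move=> ba; have : ((\sum_(i < n) b i)%:C)%C <= (M : R[i]%C).
    rewrite raddf_sum; apply: le_trans (aM n); apply: ler_sum => i _; exact: ba.
  by rewrite lecE => /andP[].
have /cvg_ex[x cx] := @real_absolutely_summable R (fun i => complex.Re (a i : R[i]%C)) _
  (fun n => re_sum _ n (fun i => norm_Re_le (a i))).
have /cvg_ex[y cy] := @real_absolutely_summable R (fun i => complex.Im (a i : R[i]%C)) _
  (fun n => re_sum _ n (fun i => norm_Im_le (a i))).
(* A positive [e] is real, so half of its real part can be allotted to each component. *)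
exists (Complex x y : cplx R); apply/cvgrPdist_lt => e; rewrite ltcE => /andP[/eqP /= e0 e_gt0].
have e2_gt0 : 0 < complex.Re (e : R[i]%C) / 2 by rewrite divr_gt0.
have /cvgrPdist_lt/(_ _ e2_gt0) nx := cx.
have /cvgrPdist_lt/(_ _ e2_gt0) ny := cy.
near=> n; apply: le_lt_trans (norm_complex_le _) _.
have ReB (z w : R[i]%C) : complex.Re (z - w) = complex.Re z - complex.Re w by case: z w => ? ? [].
have ImB (z w : R[i]%C) : complex.Im (z - w) = complex.Im z - complex.Im w by case: z w => ? ? [].
rewrite ltcE /= e0 eqxx /= ReB ImB Re_sum Im_sum /=.
rewrite [ltRHS]splitr ltrD //; near: n; [exact: nx | exact: ny].
Unshelve. all: by end_near. Qed.

(** * The coefficients of the generating function *)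

(** Bounds the product below by 1/2 uniformly in [a]; the extra term [p ^+ a] is what makes the
    induction close. *)
Lemma pochhammer_ge (K : numFieldType) (p : K) a :
  0 <= p -> 3 * p <= 1 -> 1 + p ^+ a <= 2 * \prod_(1 <= i < a.+1) (1 - p ^+ i).
Proof.
move=> p_ge0 p3; have p_le1 : p <= 1.
  by apply: le_trans p3; rewrite ler_peMl // ler1n.
elim: a => [|a IHa]; first by rewrite big_geq // expr0 mulr1.
rewrite big_nat_recr //= mulrA.
have pa_ge0 : 0 <= p ^+ a by rewrite exprn_ge0.
have pa_le1 : p ^+ a <= 1 by rewrite exprn_ile1.
have pS_le1 : p ^+ a.+1 <= 1 by rewrite exprn_ile1.
have := ler_wpM2r (_ : 0 <= 1 - p ^+ a.+1) IHa; rewrite subr_ge0 => /(_ pS_le1).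
apply: le_trans; rewrite -subr_ge0 exprS.
have -> : (1 + p ^+ a) * (1 - p * p ^+ a) - (1 + p * p ^+ a) =
  p ^+ a * ((1 - 3 * p) + p * (1 - p ^+ a)) by ring.
by rewrite mulr_ge0 // addr_ge0 ?subr_ge0 // mulr_ge0 ?subr_ge0.
Qed.

(** The partial sum times (1 - r)^2 has the closed form 1 - (1 + n (1 - r)) r^n. *)
Lemma sum_nat_geometric_le (K : numFieldType) (r : K) n :
  0 <= r -> r < 1 -> \sum_(i < n) i.+1%:R * r ^+ i <= ((1 - r) ^+ 2)^-1.
Proof.
move=> r_ge0 r_lt1; have r1 : 0 < 1 - r by rewrite subr_gt0.
rewrite -[leRHS]div1r ler_pdivlMr ?exprn_gt0 //.
have -> : (\sum_(i < n) i.+1%:R * r ^+ i) * (1 - r) ^+ 2 =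
    1 - (1 + n%:R * (1 - r)) * r ^+ n.
  elim: n => [|n IHn]; first by rewrite big_ord0; ring.
  by rewrite big_ord_recr /= mulrDl IHn [r ^+ n.+1]exprS -(natr1 n); ring.
rewrite lerBlDr lerDl mulr_ge0 ?exprn_ge0 // addr_ge0 // mulr_ge0 ?ler0n //.
exact: ltW.
Qed.

(** * Rules for limits and sums of series *)

Lemma cvg_norm_le (K : numFieldType) (s : nat -> K) (l B : K) :
  (s @ \oo --> l)%classic -> (forall n, `|s n| <= B) -> `|l| <= B.
Proof.
move=> sl sB; apply/ler_addgt0Pr => e e_gt0.
have /cvgrPdist_lt/(_ _ e_gt0)[N _ /(_ N (leqnn N)) /= slt] := sl.
rewrite -(subrK (s N) l) addrC; apply: le_trans (ler_normD _ _) _.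
by apply: lerD => //; apply: ltW.
Qed.

Lemma cvg_addl (K : numFieldType) (k l : K) (s : nat -> K) :
  (s @ \oo --> l -> (fun n => k + s n) @ \oo --> k + l)%classic.
Proof. by move=> sl; apply: cvgD => //; apply: cvg_cst. Qed.

Lemma cvg_mull (K : numFieldType) (k l : K) (s : nat -> K) :
  (s @ \oo --> l -> (fun n => k * s n) @ \oo --> k * l)%classic.
Proof. exact: cvgMr. Qed.

Lemma cvg_mul (K : numFieldType) (s t : nat -> K) (l m : K) :
  (s @ \oo --> l -> t @ \oo --> m -> (fun n => s n * t n) @ \oo --> l * m)%classic.
Proof. by move=> sl tm; apply: cvgM. Qed.

Lemma cvg_sqr (K : numFieldType) (s : nat -> K) (l : K) :
  (s @ \oo --> l -> (fun n => s n ^+ 2) @ \oo --> l ^+ 2)%classic.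
Proof. by move=> sl; under eq_fun do rewrite expr2; rewrite expr2; apply: cvgM. Qed.

Lemma cvg_even (K : numFieldType) (s : nat -> K) (l : K) :
  (s @ \oo --> l -> (fun n => s n.*2) @ \oo --> l)%classic.
Proof.
move=> sl; apply/cvgrPdist_lt => e e_gt0.
have /cvgrPdist_lt/(_ _ e_gt0)[N _ sN] := sl.
exists N => // n /= Nn; apply: sN => /=; rewrite -addnn.
exact: leq_trans Nn (leq_addr _ _).
Qed.

Lemma cvg_seq_unique (K : numFieldType) (s : nat -> K) (l m : K) :
  (s @ \oo --> l -> s @ \oo --> m -> l = m)%classic.
Proof. by move=> sl sm; apply: (cvg_unique _ sl sm). Qed.

Lemma has_sum_recr (K : numFieldType) (a b : nat -> K) (u s : K) :
  a 0%N = 0 -> (forall m, a m.+1 = u * b m) -> has_sum b s -> has_sum a (u * s).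
Proof.
move=> a0 aS bs; rewrite /has_sum -cvg_shiftS.
have -> : (fun n => series a n.+1) = (fun n => u * series b n).
  apply/funext => n; rewrite !seriesEord /= big_ord_recl a0 add0r mulr_sumr.
  by apply: eq_bigr => i _; rewrite aS.
exact: cvgMr.
Qed.

Lemma has_sumD (K : numFieldType) (a b : nat -> K) (s t : K) :
  has_sum a s -> has_sum b t -> has_sum (fun n => a n + b n) (s + t).
Proof.
move=> sa tb; rewrite /has_sum [series _](_ : _ = (fun n => series a n + series b n)).
  exact: cvgD.
by apply/funext => n; rewrite !seriesEord /= big_split.
Qed.

Lemma has_sumZ (K : numFieldType) (a : nat -> K) (k s : K) :
  has_sum a s -> has_sum (fun n => k * a n) (k * s).
Proof.
move=> sa; rewrite /has_sum [series _](_ : _ = (fun n => k * series a n)).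
  exact: cvg_mull.
by apply/funext => n; rewrite !seriesEord /= mulr_sumr.
Qed.

Lemma has_sum_unique (K : numFieldType) (a : nat -> K) (s t : K) :
  has_sum a s -> has_sum a t -> s = t.
Proof. by move=> sa ta; apply: (cvg_unique _ sa ta). Qed.

Lemma eq_has_sum (K : numFieldType) (a b : nat -> K) (s : K) :
  a =1 b -> has_sum a s -> has_sum b s.
Proof. by move=> /funext ->. Qed.

(** * Convolution coefficients: recurrences and growth *)

Section ConvolutionSeries.
Variables (K : numFieldType) (q : K).
Hypothesis q_ge3 : 3 <= q.

Let p := q ^- 2.

(** With n = a + b + 1 the exponent is n^2 - 1: one factor q of q^(n^2) is set aside for the
    prefactor of the theorem. *)
Definition mass_pair a b : K :=
  q ^+ ((a + b) ^ 2 + 2 * (a + b)) * (odd_mass q a * odd_mass q b).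

Definition diag_sum (h : nat -> nat -> K) m : K := \sum_(i < m.+1) h i (m - i)%N.

Lemma q_gt0 : 0 < q. Proof. by apply: lt_le_trans q_ge3; rewrite ltr0n. Qed.

Lemma q_ge1 : 1 <= q. Proof. by apply: le_trans q_ge3; rewrite ler1n. Qed.

Lemma q_neq0 : q != 0. Proof. by rewrite gt_eqF // q_gt0. Qed.

Lemma p_gt0 : 0 < p. Proof. by rewrite /p invr_gt0 exprn_gt0 // q_gt0. Qed.

Lemma p3_le1 : 3 * p <= 1.
Proof.
rewrite /p ler_pdivrMr ?exprn_gt0 ?q_gt0 // mul1r expr2.
by apply: le_trans q_ge3 _; rewrite ler_peMl ?q_ge1 // ltW ?q_gt0.
Qed.

Lemma pX_lt1 i : p ^+ i.+1 < 1.
Proof.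
rewrite exprn_ilt1 ?ltW ?p_gt0 //.
by apply: lt_le_trans p3_le1; rewrite ltr_pMl ?p_gt0 // ltr1n.
Qed.

Lemma qXB1_gt0 i : 0 < q ^+ (2 * i.+1) - 1.
Proof.
by rewrite subr_gt0 exprn_egt1 ?muln_eq0 // (lt_le_trans _ q_ge3) ?ltr1n.
Qed.

Lemma odd_mass_prod_gt0 a : 0 < \prod_(1 <= i < a.+1) (q ^+ (2 * i) - 1).
Proof. by rewrite big_add1 big_mkord prodr_gt0 // => i _; apply: qXB1_gt0. Qed.

Lemma odd_mass_gt0 a : 0 < odd_mass q a.
Proof. by rewrite invr_gt0 mulr_gt0 ?odd_mass_prod_gt0 // exprn_gt0 // q_gt0. Qed.

Lemma odd_massS a :
  odd_mass q a = odd_mass q a.+1 * (q ^+ (2 * a).+1 * (q ^+ (2 * a.+1) - 1)).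
Proof.
rewrite /odd_mass [in RHS]big_nat_recr //=.
have -> : (a.+1 ^ 2 = a ^ 2 + (2 * a).+1)%N by rewrite -addn1 sqrnD; lia.
rewrite exprD; move: (lt0r_neq0 (odd_mass_prod_gt0 a)) (lt0r_neq0 (qXB1_gt0 a)).
move: (expf_neq0 (a ^ 2) q_neq0) (expf_neq0 (2 * a).+1 q_neq0).
move: (\prod_(_ <= i < _) _) (q ^+ (a ^ 2)) (q ^+ (2 * a).+1) (q ^+ _ - 1) => P A B C.
by move=> A0 B0 P0 C0; field; rewrite A0 B0 P0 C0.
Qed.

Lemma mass_pairC a b : mass_pair a b = mass_pair b a.
Proof. by rewrite /mass_pair (addnC b) (mulrC (odd_mass q b)). Qed.

Lemma mass_pair_gt0 a b : 0 < mass_pair a b.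
Proof. by rewrite !mulr_gt0 ?odd_mass_gt0 // exprn_gt0 // q_gt0. Qed.

Lemma pXE i : p ^+ i = (q ^+ (2 * i))^-1.
Proof. by rewrite /p exprVn -exprM. Qed.

Lemma mass_pairSl a b :
  (1 - p ^+ a.+1) * mass_pair a.+1 b = p ^+ a * q ^+ (2 * b) * mass_pair a b.
Proof.
rewrite /mass_pair (odd_massS a).
have -> : ((a.+1 + b) ^ 2 + 2 * (a.+1 + b) =
  (a + b) ^ 2 + 2 * (a + b) + (2 * a + 2 * b + 3))%N by rewrite addSn -addn1 sqrnD; lia.
rewrite !pXE -[(2 * a).+1]addn1 mulnS !exprD expr1.
by field; rewrite expf_neq0 // q_neq0.
Qed.

Lemma mass_pairSr a b :
  (1 - p ^+ b.+1) * mass_pair a b.+1 = p ^+ b * q ^+ (2 * a) * mass_pair a b.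
Proof. by rewrite mass_pairC mass_pairSl mass_pairC. Qed.

Lemma diag_sumSl (h : nat -> nat -> K) m :
  (forall b, h 0%N b = 0) -> diag_sum h m.+1 = diag_sum (fun a b => h a.+1 b) m.
Proof.
move=> h0; rewrite /diag_sum big_ord_recl h0 add0r; apply: eq_bigr => i _.
by rewrite lift0 subSS.
Qed.

Lemma diag_sumC (h : nat -> nat -> K) m :
  diag_sum (fun a b => h b a) m = diag_sum h m.
Proof.
rewrite /diag_sum [RHS](reindex_inj rev_ord_inj) /=; apply: eq_bigr => i _.
by rewrite subSS subKn // -ltnS.
Qed.

Lemma diag_sumSr (h : nat -> nat -> K) m :
  (forall a, h a 0%N = 0) -> diag_sum h m.+1 = diag_sum (fun a b => h a b.+1) m.
Proof. by move=> h0; rewrite -diag_sumC diag_sumSl // diag_sumC. Qed.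

Lemma eq_diag_sum (h k : nat -> nat -> K) m :
  (forall a b, (a + b = m)%N -> h a b = k a b) -> diag_sum h m = diag_sum k m.
Proof. by move=> hk; apply: eq_bigr => i _; apply: hk; rewrite subnKC // -ltnS. Qed.

Lemma diag_sumD (h k : nat -> nat -> K) m :
  diag_sum (fun a b => h a b + k a b) m = diag_sum h m + diag_sum k m.
Proof. exact: big_split. Qed.

Lemma diag_sumZ (h : nat -> nat -> K) (x : K) m :
  diag_sum (fun a b => x * h a b) m = x * diag_sum h m.
Proof. by rewrite /diag_sum mulr_sumr. Qed.

(** Of these, [coef_c] gives the series c(u); the weighted sums [coef_d] and [coef_e] are the
    companions with which its recurrences close up. *)
Definition coef_c := diag_sum mass_pair.
Definition coef_d := diag_sum (fun a b => p ^+ a * q ^+ (2 * b) * mass_pair a b).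
Definition coef_e := diag_sum (fun a b => p ^+ b * mass_pair a b).

Lemma coef_d_sym m : coef_d m = diag_sum (fun a b => p ^+ b * q ^+ (2 * a) * mass_pair a b) m.
Proof.
rewrite /coef_d -diag_sumC; apply: eq_diag_sum => a b _; by rewrite mass_pairC.
Qed.

Lemma pqE a : p ^+ a * q ^+ (2 * a) = 1.
Proof. by rewrite pXE mulVf // expf_neq0 // q_neq0. Qed.

Lemma coef_c0 : coef_c 0 = 1.
Proof.
rewrite /coef_c /diag_sum big_ord1 /mass_pair /odd_mass !big_geq // !expr0.
by rewrite !mulr1 !invr1 !mulr1.
Qed.

Lemma coef_e0 : coef_e 0 = 1.
Proof. by rewrite -coef_c0 /coef_e /coef_c /diag_sum !big_ord1 mul1r. Qed.

Lemma coef_d0 : coef_d 0 = 1.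
Proof. by rewrite -coef_c0 /coef_d /coef_c /diag_sum !big_ord1 !mul1r. Qed.

(** Split 1 = p^b + (1 - p^b); the second part lowers [b] by [mass_pairSr]. *)
Lemma coef_cE m : coef_c m.+1 = coef_e m.+1 + coef_d m.
Proof.
rewrite coef_d_sym -(eq_diag_sum (fun a b _ => mass_pairSr a b)).
rewrite -(@diag_sumSr (fun a b => (1 - p ^+ b) * mass_pair a b)) => [|a].
  by rewrite -diag_sumD; apply: eq_diag_sum => a b _; ring.
by rewrite subrr mul0r.
Qed.

(** Split 1 - p^(a+b) = (1 - p^a) + p^a (1 - p^b); the two parts lower [a] and [b] respectively. *)
Lemma coef_cS m : (1 - p ^+ m.+1) * coef_c m.+1 = coef_d m + coef_e m.
Proof.
rewrite [coef_d m]/coef_d -(eq_diag_sum (fun a b _ => mass_pairSl a b)).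
rewrite -(@diag_sumSl (fun a b => (1 - p ^+ a) * mass_pair a b)) => [|b]; last first.
  by rewrite subrr mul0r.
have -> : coef_e m =
    diag_sum (fun a b => p ^+ a * ((1 - p ^+ b.+1) * mass_pair a b.+1)) m.
  apply: eq_diag_sum => a b _; rewrite mass_pairSr.
  by rewrite -[LHS]mul1r -(pqE a); ring.
rewrite -(@diag_sumSr (fun a b => p ^+ a * ((1 - p ^+ b) * mass_pair a b))) => [|a].
  rewrite -diag_sumD -diag_sumZ; apply: eq_diag_sum => a b <-; rewrite exprD; ring.
by rewrite subrr mul0r mulr0.
Qed.

(** Since p q^2 = 1, the weight p^a q^(2b) equals p^(a+b) + p^a q^(2b) (1 + p^b) (1 - p^b), and the
    last factor lowers [b]. *)
Lemma coef_dE m : coef_d m.+1 = p ^+ m.+1 * coef_c m.+1 + (q ^+ 2 * coef_c m + coef_e m).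
Proof.
have -> : q ^+ 2 * coef_c m + coef_e m = diag_sum (fun a b =>
    p ^+ a * q ^+ (2 * b.+1) * (1 + p ^+ b.+1) * ((1 - p ^+ b.+1) * mass_pair a b.+1)) m.
  rewrite -diag_sumZ -diag_sumD; apply: eq_diag_sum => a b _; rewrite mass_pairSr.
  transitivity (p ^+ a * q ^+ (2 * a) * (p ^+ b * q ^+ (2 * b)) * (q ^+ 2 * mass_pair a b)
    + p ^+ a * q ^+ (2 * a) * (p ^+ b.+1 * q ^+ (2 * b.+1)) * (p ^+ b * mass_pair a b)).
    by rewrite !pqE !mul1r.
  by rewrite [in LHS](mulnS 2 b) [in RHS](mulnS 2 b) !exprD; ring.
rewrite -(@diag_sumSr (fun a b =>
    p ^+ a * q ^+ (2 * b) * (1 + p ^+ b) * ((1 - p ^+ b) * mass_pair a b))) => [|a].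
  rewrite -diag_sumZ -diag_sumD; apply: eq_diag_sum => a b <-.
  transitivity (p ^+ (a + b) * mass_pair a b +
    (p ^+ a * q ^+ (2 * b) * mass_pair a b
     - p ^+ b * q ^+ (2 * b) * (p ^+ a * p ^+ b) * mass_pair a b)); last by ring.
  by rewrite pqE mul1r -exprD addrC subrK.
by rewrite subrr mul0r mulr0.
Qed.

(** By [pochhammer_ge], [odd_mass q i] is at most 2 / q^(2i^2 + i); then (a + b)^2 <= 2a^2 + 2b^2.
    This growth gives convergence for |u| < 1/q. *)
Lemma mass_pair_le a b : mass_pair a b <= 4 * q ^+ (a + b).
Proof.
have mass_le i : q ^+ (2 * i ^ 2 + i) * odd_mass q i <= 2.
  rewrite /odd_mass ler_pdivrMr; last first.
    by rewrite mulr_gt0 ?odd_mass_prod_gt0 // exprn_gt0 // q_gt0.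
  have -> : \prod_(1 <= j < i.+1) (q ^+ (2 * j) - 1) =
      q ^+ (i ^ 2 + i) * \prod_(1 <= j < i.+1) (1 - p ^+ j).
    elim: i => [|i IHi]; first by rewrite !big_geq // mulr1.
    rewrite [LHS]big_nat_recr //= [in RHS]big_nat_recr //= IHi.
    have -> : (i.+1 ^ 2 + i.+1 = i ^ 2 + i + 2 * i.+1)%N by rewrite -addn1 sqrnD; lia.
    move: (\prod_(_ <= _ < _) _) => P; rewrite [in RHS]exprD -[in LHS](pqE i.+1).
    by move: (q ^+ (2 * i.+1)) (p ^+ i.+1) => X y; ring.
  move: (pochhammer_ge i (ltW p_gt0) p3_le1); move: (\prod_(_ <= _ < _) _) => P P_ge.
  rewrite mulrCA (mulrCA 2) mulrA -exprD addnA addnn -mul2n ler_peMr ?exprn_ge0 ?(ltW q_gt0) //.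
  apply: le_trans P_ge.
  by rewrite lerDl exprn_ge0 // (ltW p_gt0).
have sq : ((a + b) ^ 2 + 2 * (a + b) <= (2 * a ^ 2 + a) + (2 * b ^ 2 + b) + (a + b))%N.
  have := (nat_AGM2 a b).1; rewrite sqrnD; lia.
have q0 := ltW q_gt0; have q1 := q_ge1.
rewrite /mass_pair; apply: le_trans (ler_wpM2r _ (ler_weXn2l q1 sq)) _.
  by rewrite mulr_ge0 // ltW ?odd_mass_gt0.
rewrite 2!exprD [X in X <= _](_ : _ = q ^+ (2 * a ^ 2 + a) * odd_mass q a *
  (q ^+ (2 * b ^ 2 + b) * odd_mass q b) * q ^+ (a + b)); last by ring.
rewrite ler_wpM2r ?exprn_ge0 // -[4]/(2 * 2)%:R natrM.
by rewrite ler_pM // mulr_ge0 ?exprn_ge0 // ltW ?odd_mass_gt0.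
Qed.
End ConvolutionSeries.

(** * The functional equation and the product formula *)

(** The factor at i = 0 is 2. The others have product at most 2, as (1 + x)(1 - x) <= 1 and the
    product of the 1 - p^i is at least 1/2. *)
Lemma prod_1p_le (K : numFieldType) (p : K) n :
  0 <= p -> 3 * p <= 1 -> \prod_(i < n) (1 + p ^+ i) <= 4.
Proof.
move=> p_ge0 p3; have p_le1 : p <= 1 by apply: le_trans p3; rewrite ler_peMl // ler1n.
case: n => [|n]; first by rewrite big_ord0 ler1n.
have -> : \prod_(i < n.+1) (1 + p ^+ i) = 2 * \prod_(1 <= i < n.+1) (1 + p ^+ i).
  by rewrite big_ord_recl expr0 big_add1 big_mkord.
have -> : (4 : K) = 2 * 2 by rewrite -natrM.
rewrite ler_pM2l ?ltr0n //.
have P_ge := pochhammer_ge n p_ge0 p3.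
set A := \prod_(_ <= _ < _) _; set B := \prod_(_ <= _ < _) _ in P_ge.
have AB : A * B <= 1.
  rewrite /A /B -big_split big_add1 big_mkord; apply: prodr_ile1 => i _.
  have y_ge0 : 0 <= p ^+ i.+1 by rewrite exprn_ge0.
  rewrite /= (mulr_ge0 (addr_ge0 ler01 y_ge0)) ?subr_ge0 ?exprn_ile1 //=.
  rewrite -subr_ge0 [X in 0 <= X](_ : _ = p ^+ i.+1 * p ^+ i.+1); last by ring.
  exact: mulr_ge0.
have A_ge0 : 0 <= A.
  by rewrite /A big_add1 big_mkord prodr_ge0 // => i _; rewrite addr_ge0 ?exprn_ge0.
apply: (@le_trans _ _ (A * (2 * B))); last by rewrite mulrCA ler_piMr ?ler0n.
rewrite ler_peMr //; apply: le_trans P_ge; by rewrite lerDl exprn_ge0.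
Qed.

(** Consecutive partial products differ by P_n w p^n, which is summable because the P_n are
    bounded. *)
Lemma qproduct_cvg (R : realType) (p w : cplx R) :
  0 <= p -> 3 * p <= 1 -> `|w| <= 1 ->
  exists2 P : cplx R, ((fun n => \prod_(i < n) (1 + w * p ^+ i)) @ \oo --> P)%classic
    & (1 + w != 0 -> P != 0).
Proof.
move=> p_ge0 p3 w_le1; pose P n := \prod_(i < n) (1 + w * p ^+ i).
have p_lt1 : p < 1.
  have [->|p_neq0] := eqVneq p 0; first exact: ltr01.
  by apply: lt_le_trans p3; rewrite ltr_pMl ?ltr1n // lt_def p_neq0.
have wp_le i : `|w * p ^+ i| <= p ^+ i.
  by rewrite normrM normrX (ger0_norm p_ge0) ler_piMl ?exprn_ge0.
have P_le n : `|P n| <= 4.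
  rewrite normr_prod; apply: le_trans (prod_1p_le n p_ge0 p3).
  apply: ler_prod => i _; rewrite normr_ge0 (le_trans (ler_normD _ _)) //.
  by rewrite normr1 lerD2l.
pose a n := P n * (w * p ^+ n).
have [s as_] : exists s, has_sum a s.
  apply: (@cplx_absolutely_summable _ _ (4 * ((1 - p) ^+ 2)^-1)) => n.
  apply: le_trans (ler_wpM2l (ler0n _ 4) (sum_nat_geometric_le n p_ge0 p_lt1)).
  rewrite mulr_sumr; apply: ler_sum => i _; rewrite normrM ler_pM //.
  by apply: le_trans (wp_le i) _; rewrite ler_peMl ?exprn_ge0 // ler1n.
have PE : P = (fun n => 1 + series a n).
  apply/funext; elim=> [|n IHn]; first by rewrite /P big_ord0 seriesEord /= big_ord0 addr0.
  rewrite seriesSr addrA -IHn /P big_ord_recr /= /a -/(P n); ring.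
have cP : (P @ \oo --> 1 + s)%classic by rewrite PE; apply: cvg_addl.
exists (1 + s) => // w1; apply/eqP => s0; rewrite s0 in cP.
(* Only the factor at i = 0 can be small; the others have modulus at least 1 - p^i, with product at
   least 1/2. *)
have P_ge n : `|1 + w| / 2 <= `|P n.+1|.
  rewrite /P big_ord_recl /= expr0 mulr1 normrM ler_wpM2l // normr_prod.
  apply: (@le_trans _ _ (\prod_(1 <= i < n.+1) (1 - p ^+ i))).
    rewrite -[2^-1]mul1r ler_pdivrMr ?ltr0n // mulrC.
    by apply: le_trans (pochhammer_ge n p_ge0 p3); rewrite lerDl exprn_ge0.
  rewrite big_add1 big_mkord; apply: ler_prod => i _; rewrite subr_ge0.
  rewrite exprn_ile1 ?(ltW p_lt1) //=.
  apply: le_trans (lerB_normD _ _); rewrite normr1 lerD2l lerN2.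
  exact: wp_le.
have w1_gt0 : 0 < `|1 + w| / 2 by rewrite divr_gt0 ?normr_gt0 ?ltr0n.
have /cvgrPdist_lt/(_ _ w1_gt0)[N _ /(_ N.+1 (leqnSn N)) /=] := cP.
by rewrite sub0r normrN => /lt_le_trans/(_ (P_ge N)); rewrite ltxx.
Qed.

Section FunctionalEquation.
Variables (R : realType) (q : cplx R).
Hypothesis q_ge3 : 3 <= q.

Let p := q ^- 2.

(** The i-th diagonal has i + 1 terms, each at most C q^i, which leads to the series of (i + 1) (q
    |u|)^i. *)
Lemma diag_sum_summable (h : nat -> nat -> cplx R) (C u : cplx R) :
  0 <= C -> (forall a b, 0 <= h a b <= C * q ^+ (a + b)) -> `|u| < q^-1 ->
  exists B, forall n, \sum_(i < n) `|diag_sum h i * u ^+ i| <= B.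
Proof.
move=> C_ge0 hC u_lt; have q0 := q_gt0 q_ge3.
have r_ge0 : 0 <= q * `|u| by rewrite mulr_ge0 // ltW.
have r_lt1 : q * `|u| < 1 by rewrite mulrC -ltr_pdivlMr // div1r.
exists (C * ((1 - q * `|u|) ^+ 2)^-1) => n.
apply: le_trans (ler_wpM2l C_ge0 (sum_nat_geometric_le n r_ge0 r_lt1)).
rewrite mulr_sumr; apply: ler_sum => i _; rewrite normrM normrX exprMn !mulrA.
rewrite ler_wpM2r ?exprn_ge0 //.
apply: le_trans (ler_norm_sum _ _ _) _.
apply: (@le_trans _ _ (\sum_(j < i.+1) C * q ^+ i)).
  apply: ler_sum => j _; have /andP[h0 h1] := hC j (i - j)%N.
  by rewrite ger0_norm // (le_trans h1) // subnKC // -ltnS.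
by rewrite sumr_const card_ord -[leLHS]mulr_natr mulrAC.
Qed.

Lemma coef_c_summable (u : cplx R) : `|u| < q^-1 ->
  exists B, forall n, \sum_(i < n) `|coef_c q i * u ^+ i| <= B.
Proof.
apply: (@diag_sum_summable _ 4); first exact: ler0n.
by move=> a b; rewrite (ltW (mass_pair_gt0 q_ge3 a b)) mass_pair_le.
Qed.

Lemma coef_e_summable (u : cplx R) : `|u| < q^-1 ->
  exists B, forall n, \sum_(i < n) `|coef_e q i * u ^+ i| <= B.
Proof.
apply: (@diag_sum_summable _ 4); first exact: ler0n.
move=> a b; have f_ge0 := ltW (mass_pair_gt0 q_ge3 a b).
have p_ge0 := ltW (p_gt0 q_ge3).
rewrite mulr_ge0 ?exprn_ge0 //= (le_trans _ (mass_pair_le q_ge3 a b)) //.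
rewrite ler_piMl // exprn_ile1 //.
by have := ltW (pX_lt1 q_ge3 0); rewrite expr1.
Qed.

(** The growing weight q^(2b) is absorbed by [mass_pairSl], which moves the bound to
    [mass_pair a.+1 b] at the cost of one factor q. *)
Lemma coef_d_summable (u : cplx R) : `|u| < q^-1 ->
  exists B, forall n, \sum_(i < n) `|coef_d q i * u ^+ i| <= B.
Proof.
have q0 := q_gt0 q_ge3.
apply: (@diag_sum_summable _ (4 * q)); first by rewrite mulr_ge0 ?ler0n // ltW.
move=> a b; rewrite -mass_pairSl // -mulrA -exprS.
have f_ge0 := ltW (mass_pair_gt0 q_ge3 a.+1 b).
have p_ge0 := ltW (p_gt0 q_ge3).
have pX_le1 := ltW (pX_lt1 q_ge3 a).
rewrite mulr_ge0 ?subr_ge0 //= (le_trans _ (mass_pair_le q_ge3 a.+1 b)) //.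
by rewrite ler_piMl // gerBl exprn_ge0.
Qed.

Definition series_c (v : cplx R) : cplx R := limn (series (fun m => coef_c q m * v ^+ m)).

Lemma has_sum_series_c (v : cplx R) :
  `|v| < q^-1 -> has_sum (fun m => coef_c q m * v ^+ m) (series_c v).
Proof.
move=> /coef_c_summable[B hB].
have [s cs] := @cplx_absolutely_summable R (fun m => coef_c q m * v ^+ m) B hB.
exact: (cvgP s cs).
Qed.

(** The three recurrences become the linear relations [C1], [C2], [D1] between c(u), c(pu) and the
    two companion series; eliminating the companions leaves the equation. *)
Lemma series_c_functional (u : cplx R) : `|u| < q^-1 ->
  (1 + u) * series_c (p * u) = (1 - u) * (1 - u ^+ 2 * q ^+ 2) * series_c u.
Proof.
move=> u_lt; have p_ge0 := ltW (p_gt0 q_ge3).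
have p_le1 : p <= 1 by have := ltW (pX_lt1 q_ge3 0); rewrite expr1.
have pu_lt : `|p * u| < q^-1.
  by apply: le_lt_trans u_lt; rewrite normrM (ger0_norm p_ge0) ler_piMl.
have hC := has_sum_series_c u_lt; have hC' := has_sum_series_c pu_lt.
have [B hB] := coef_d_summable u_lt.
have [D hD] := @cplx_absolutely_summable R (fun m => coef_d q m * u ^+ m) B hB.
have [B' hB'] := coef_e_summable u_lt.
have [E hE] := @cplx_absolutely_summable R (fun m => coef_e q m * u ^+ m) B' hB'.
set C := series_c u in hC *; set C' := series_c _ in hC' *.
pose shift (b : nat -> cplx R) m := if m is m'.+1 then u * b m' else 0.
have hshift b s : has_sum b s -> has_sum (shift b) (u * s) by exact: has_sum_recr.
have C1 : C = E + u * D.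
  apply: has_sum_unique hC _; apply: (eq_has_sum _ (has_sumD hE (hshift _ _ hD)))=> -[|m] /=.
    by rewrite coef_c0 coef_e0 addr0.
  by rewrite coef_cE // exprS; ring.
have C2 : C = C' + u * (D + E).
  apply: has_sum_unique hC _.
  apply: (eq_has_sum _ (has_sumD hC' (hshift _ _ (has_sumD hD hE))))=> -[|m] /=.
    by rewrite !expr0 addr0.
  by rewrite -mulrDl -coef_cS // exprMn [u ^+ m.+1]exprS /p; ring.
have D1 : D = C' + u * (q ^+ 2 * C + E).
  have h3 := has_sumD hC' (hshift _ _ (has_sumD (has_sumZ (k := q ^+ 2) hC) hE)).
  apply: has_sum_unique hD _.
  apply: (eq_has_sum _ h3) => -[|m] /=.
    by rewrite !expr0 addr0 coef_d0 coef_c0.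
  by rewrite coef_dE // exprMn [u ^+ m.+1]exprS /p; ring.
have E' : E = C - u * D by rewrite C1 addrK.
have Cp : C' = C - u * (D + E) by rewrite {1}C2 addrK.
have Dq : (1 + u) * D = (1 + q ^+ 2 * u) * C.
  by rewrite mulrDl mul1r {1}D1 Cp E'; ring.
transitivity ((1 - u) * ((1 + u) * C - u * ((1 + u) * D))); last by rewrite Dq; ring.
by rewrite Cp E'; ring.
Qed.

(** At v = p^N u the functional equation is multiplied by 1 + v: the square appears on the right,
    and (1 - v^2)(1 - q^2 v^2) gives two consecutive factors on the left because p q^2 = 1. *)
Lemma series_c_iterate (u : cplx R) N : `|u| < q^-1 ->
  series_c u * \prod_(i < N.*2) (1 + - (u ^+ 2 * q ^+ 2) * p ^+ i) =
  (\prod_(i < N) (1 + u * p ^+ i)) ^+ 2 * series_c (p ^+ N * u).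
Proof.
move=> u_lt; have p_ge0 := ltW (p_gt0 q_ge3).
have p_le1 : p <= 1 by have := ltW (pX_lt1 q_ge3 0); rewrite expr1.
elim: N => [|N IHN]; first by rewrite double0 !big_ord0 expr1n expr0 !mul1r mulr1.
have v_lt : `|p ^+ N * u| < q^-1.
  apply: le_lt_trans u_lt; rewrite normrM normrX (ger0_norm p_ge0) ler_piMl //.
  exact: exprn_ile1.
have FE := series_c_functional v_lt.
have pq : p * q ^+ 2 = 1 by rewrite mulVf // expf_neq0 // q_neq0.
rewrite doubleS !big_ord_recr /= 2!mulrA IHN [p ^+ N.+1]exprS -[p * _ * u]mulrA.
transitivity ((\prod_(i < N) (1 + u * p ^+ i)) ^+ 2 *
  ((1 + p ^+ N * u) * ((1 - p ^+ N * u) * (1 - (p ^+ N * u) ^+ 2 * q ^+ 2) *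
   series_c (p ^+ N * u)))).
  have pD : p ^+ N.*2 = (p ^+ N) ^+ 2 by rewrite -exprM muln2.
  rewrite [p ^+ N.*2.+1]exprS pD.
  have -> : 1 + - (u ^+ 2 * q ^+ 2) * (p * (p ^+ N) ^+ 2) =
      1 - u ^+ 2 * (p ^+ N) ^+ 2 * (p * q ^+ 2).
    by ring.
  by rewrite pq; ring.
by rewrite -FE; ring.
Qed.

(** The constant coefficient is 1 and every later term carries at least one factor p^N, so the
    distance to 1 is at most p^N times a fixed bound. *)
Lemma series_c_cvg1 (u : cplx R) : `|u| < q^-1 ->
  ((fun N => series_c (p ^+ N * u)) @ \oo --> (1 : cplx R))%classic.
Proof.
move=> u_lt; have p_ge0 := ltW (p_gt0 q_ge3).
have p_lt1 : p < 1 by have := pX_lt1 q_ge3 0; rewrite expr1.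
have [B B_ge] := coef_c_summable u_lt.
have S_le N : `|series_c (p ^+ N * u) - 1| <= p ^+ N * B.
  have v_lt : `|p ^+ N * u| < q^-1.
    apply: le_lt_trans u_lt; rewrite normrM normrX (ger0_norm p_ge0) ler_piMl //.
    by apply: exprn_ile1 => //; apply: ltW.
  have := has_sum_series_c v_lt; rewrite /has_sum -cvg_shiftS => cS.
  pose t n := -1 + series (fun m => coef_c q m * (p ^+ N * u) ^+ m) n.+1.
  have cS1 : (t @ \oo --> -1 + series_c (p ^+ N * u))%classic.
    exact: cvg_addl.
  rewrite addrC.
  apply: (cvg_norm_le cS1) => n; rewrite /t seriesEord /= big_ord_recl coef_c0 //.
  rewrite expr0 mulr1 addrA addNr add0r; apply: le_trans (ler_norm_sum _ _ _) _.
  apply: le_trans (ler_wpM2l _ (B_ge n.+1)); last by rewrite exprn_ge0.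
  rewrite big_ord_recl mulrDr; apply: ler_wpDl; first by rewrite mulr_ge0 ?exprn_ge0.
  rewrite mulr_sumr; apply: ler_sum => i _; rewrite exprMn mulrCA normrM.
  have pN_ge0 : 0 <= p ^+ N by rewrite exprn_ge0.
  have pN_le1 : p ^+ N <= 1 by rewrite exprn_ile1 ?(ltW p_lt1).
  rewrite ler_wpM2r ?normr_ge0 // lift0 normrX (ger0_norm pN_ge0) exprS.
  by apply: ler_piMr => //; apply: exprn_ile1.
have pN0 : ((fun N => p ^+ N * B) @ \oo --> (0 : cplx R))%classic.
  have [s ps] : exists s, has_sum (fun N => p ^+ N) s.
    apply: (@cplx_absolutely_summable _ _ ((1 - p) ^+ 2)^-1) => n.
    apply: le_trans (sum_nat_geometric_le n p_ge0 p_lt1); apply: ler_sum => i _.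
    by rewrite ger0_norm ?exprn_ge0 // ler_peMl ?exprn_ge0 // ler1n.
  by rewrite -(mul0r B); apply: cvg_mul (cvg_cst _); apply: cvg_series_cvg_0; apply: (cvgP s ps).
apply/cvgrPdist_lt => e e_gt0; have /cvgrPdist_lt/(_ _ e_gt0) pe := pN0.
near=> N; rewrite distrC; apply: le_lt_trans (S_le N) _.
have pB_ge0 : 0 <= p ^+ N * B by apply: le_trans (S_le N); exact: normr_ge0.
by rewrite -(ger0_norm pB_ge0) -normrN -sub0r; near: N.
Unshelve. all: by end_near. Qed.

Lemma series_c_product (u : cplx R) : `|u| < q^-1 ->
  exists Pnum Pden : cplx R,
    [/\ ((fun N => (\prod_(i < N) (1 + u * p ^+ i)) ^+ 2) @ \oo --> Pnum)%classic,
        ((fun N => \prod_(i < N) (1 + - (u ^+ 2 * q ^+ 2) * p ^+ i)) @ \oo --> Pden)%classic,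
        Pden != 0 & series_c u = Pnum / Pden].
Proof.
move=> u_lt; have p_ge0 := ltW (p_gt0 q_ge3); have p3 := p3_le1 q_ge3.
have uq_lt1 : `|u * q| < 1.
  by rewrite normrM (ger0_norm (ltW (q_gt0 q_ge3))) -ltr_pdivlMr ?q_gt0 // div1r.
have u_le1 : `|u| <= 1.
  by apply: le_trans (ltW u_lt) _; rewrite invf_le1 ?q_gt0 // q_ge1.
have w_lt1 : `|- (u ^+ 2 * q ^+ 2)| < 1.
  by rewrite normrN -exprMn normrX exprn_ilt1.
have [A cA _] := qproduct_cvg p_ge0 p3 u_le1.
have [Pden cD D_neq0] := qproduct_cvg p_ge0 p3 (ltW w_lt1).
(* The first factor 1 - u^2 q^2 is nonzero because |u q| < 1. *)
have D0 : Pden != 0.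
  apply: D_neq0; rewrite subr_eq0 eq_sym; apply: contraTneq w_lt1 => ->.
  by rewrite normrN normr1 ltxx.
have cN : ((fun N => (\prod_(i < N) (1 + u * p ^+ i)) ^+ 2) @ \oo --> A ^+ 2)%classic.
  exact: cvg_sqr cA.
exists (A ^+ 2), Pden; split; [exact: cN | exact: cD | exact: D0 | ].
apply: (mulIf D0); rewrite divfK //.
have cR : ((fun N => (\prod_(i < N) (1 + u * p ^+ i)) ^+ 2 * series_c (p ^+ N * u))
    @ \oo --> A ^+ 2)%classic.
  by rewrite -[A ^+ 2]mulr1; apply: cvg_mul cN (series_c_cvg1 u_lt).
(* The iteration produces 2N denominator factors, hence the limit along even indices. *)
have cL : ((fun N => series_c u * \prod_(i < N.*2) (1 + - (u ^+ 2 * q ^+ 2) * p ^+ i))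
    @ \oo --> series_c u * Pden)%classic := cvg_mull (cvg_even cD).
have E : (fun N => series_c u * \prod_(i < N.*2) (1 + - (u ^+ 2 * q ^+ 2) * p ^+ i)) =
    (fun N => (\prod_(i < N) (1 + u * p ^+ i)) ^+ 2 * series_c (p ^+ N * u)).
  by apply/funext => N; apply: series_c_iterate.
by rewrite E in cL; exact: (cvg_seq_unique cL cR).
Qed.

End FunctionalEquation.

(** The term at n = m + 1 is u q / 2 times the m-th term of c(u), by (m + 1)^2 = m^2 + 2m + 1. *)
Lemma has_sum_mass (K : numFieldType) (q u s : K) (t : nat -> K) :
  q != 0 ->
  t 0%N = 0 ->
  (forall n, t n.+1 = 2^-1 * (\sum_(a < n.+1) odd_mass q a * odd_mass q (n.+1 - a.+1))
     * q ^+ (n.+1 ^ 2) * u ^+ n.+1) ->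
  has_sum (fun m => coef_c q m * u ^+ m) s -> has_sum t (u * q / 2 * s).
Proof.
move=> q_neq0 t0 tS; apply: has_sum_recr => // m; rewrite tS.
rewrite /coef_c /diag_sum /mass_pair !mulr_sumr !mulr_suml !mulr_sumr.
apply: eq_bigr => i _; rewrite subSS subnKC; last by rewrite -ltnS.
have -> : (m.+1 ^ 2 = (m ^ 2 + 2 * m).+1)%N by rewrite -addn1 sqrnD; lia.
by rewrite [q ^+ _.+1]exprS [u ^+ m.+1]exprS; field.
Qed.

Theorem theorem6p2 (R : realType) (F : finFieldType) (delta : F) (u : cplx R)
    (hodd : odd #|F|) (hdelta : forall x : F, x ^+ 2 != delta)
    (hu : `|u| < #|F|%:R^-1) :
  let q : cplx R := #|F|%:R in
  exists Pnum Pden : cplx R,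
    [/\ has_prod (fun i : nat => (1 + u / q ^ (2 * (i%:Z - 1))) ^+ 2) Pnum,
        has_prod (fun i : nat => 1 - u ^+ 2 / q ^ (2 * (i%:Z - 2))) Pden,
        Pden != 0,
        has_sum (term_plus F u) (u * q / 2 * (Pnum / Pden))
      & has_sum (term_minus delta u) (u * q / 2 * (Pnum / Pden))].
Proof.
move=> q.
have nsd : ~~ is_square delta by apply/existsPn => x; rewrite eq_sym.
have q_ge3 : 3 <= q.
  rewrite ler_nat; have := card_finNzRing_gt1 F; move: hodd; move: #|F| => n; lia.
have qn0 := q_neq0 q_ge3.
have [Pnum [Pden [cN cD D0 SE]]] := series_c_product q_ge3 hu.
have hS := has_sum_series_c q_ge3 hu; rewrite SE in hS.
exists Pnum, Pden; split.
- rewrite /has_prod [X in (X @ _)%classic](_ : _ =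
    (fun N => (\prod_(i < N) (1 + u * q ^- 2 ^+ i)) ^+ 2)); first exact: cN.
  apply/funext => N; rewrite big_add1 big_mkord -prodrXl; apply: eq_bigr => i _.
  have -> : 2 * (i.+1%:Z - 1) = (2 * i)%N :> int by lia.
  by rewrite -exprnP exprVn -exprM.
- rewrite /has_prod [X in (X @ _)%classic](_ : _ =
    (fun N => \prod_(i < N) (1 + - (u ^+ 2 * q ^+ 2) * q ^- 2 ^+ i))); first exact: cD.
  apply/funext => N; rewrite big_add1 big_mkord; apply: eq_bigr => i _.
  (* Reindexing from 0 turns q^(2(i-2)) into q^(2i-2), so its inverse is q^2 p^i; at i = 0 the
     exponent is negative, hence integer powers. *)
  have -> : 2 * (i.+1%:Z - 2) = (2 * i)%N%:Z - 2%N%:Z :> int by lia.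
  rewrite expfzDr // -exprnN -exprnP exprVn -exprM; field.
  by rewrite expf_neq0.
- exact: D0.
- apply: has_sum_mass hS => // [|n]; rewrite /term_plus.
    by rewrite (plus_mass _ _ hodd nsd) big_ord0 mulr0 !mul0r.
  by rewrite (plus_mass _ _ hodd nsd).
- apply: has_sum_mass hS => // [|n]; rewrite /term_minus /=.
    (* At n = 0 the term vanishes through the convention in [inv_card_O_minus]. *)
    by rewrite mulr0 !mul0r.
  by rewrite (minus_mass _ _ hodd nsd).
Qed.
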